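(* Consider a single-integrator multi-agent system of $N$ agents with positions $\mathbf{x}_i\in\mathbb{R}^n$ and dynamics $\dot{\mathbf{x}}_i=\mathbf{u}_i$, $i=1,\dots,N$, with time-varying communication delays $0\le d_{ji}(t)\le\overline{d}_{ji}$ from agent $j$ to agent $i$. Assume that the undirected communication graph is initially connected and that each pair of initially adjacent agents is strictly within communication distance: for some $\epsilon>0$, $|\mathbf{x}_i(0)-\mathbf{x}_j(0)|\le r-\epsilon$ for all $(i,j)\in\mathcal{E}(0)$. Let the controls be generated by $$\dot{\mathbf{u}}_i=-p\sum_{j\in\mathcal{N}_i(0)}\nabla_i\psi(|\mathbf{x}^d_{ij}|)-\mathbf{K}_i\mathbf{u}_i,\qquad \mathbf{u}_i(0)=\mathbf{0},$$ where $p>0$, $\mathbf{K}_i$ is a positive diagonal gain matrix with smallest eigenvalue $k_i$, and $\psi$ is the potential given in the context, with parameter $Q>0$ such that $\frac{N(N-1)}{2}\psi(r-\epsilon)<\psi(r)$. Let $\gamma,\eta>0$ be constants for which the gradient-mismatch property stated in the context holds. If the damping gains $\mathbf{K}_i$ are selected such that, for every $i=1,\dots,N$, $$k_i>\sum_{j\in\mathcal{N}_i(0)}\left(\frac{\alpha_{ij}\,p(\gamma+\eta)}{2}+\frac{p(\gamma+n\eta)\,\overline{d}_{ij}^{\,2}}{2\alpha_{ji}}\right),$$ with $\alpha_{ij}$ positive constants, then the controls maintain the initial connectivity of the system, i.e. $|\mathbf{x}_i(t)-\mathbf{x}_j(t)|<r$ for all $(i,j)\in\mathcal{E}(0)$ and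 all $t\ge0$, and coordinate it, i.e. $\mathbf{x}_i(t)-\mathbf{x}_j(t)\to\mathbf{0}$ as $t\to\infty$ for all $i,j\in\{1,\dots,N\}$.
   Context: $r>0$ is the common broadcasting radius of the agents and $|\cdot|$ is the Euclidean norm. $\mathcal{E}(0)$ is the initial edge set of the undirected communication graph ($(i,j)\in\mathcal{E}(0)$ iff $(j,i)\in\mathcal{E}(0)$), and $\mathcal{N}_i(0)=\{j:(i,j)\in\mathcal{E}(0)\}$ is the set of initial neighbours of agent $i$. The communication graph is treated as static (no new links are created), and maintaining connectivity means maintaining all initial communication links. Notation: $\mathbf{x}_{ij}=\mathbf{x}_i-\mathbf{x}_j$; $\mathbf{x}_{jd}=\mathbf{x}_j(t-d_{ji}(t))$ is the delayed position of agent $j$ received by agent $i$; $\mathbf{x}^d_{ij}=\mathbf{x}_i(t)-\mathbf{x}_j(t-d_{ji}(t))$. Potential: for $Q>0$, $\psi(|\mathbf{x}_{ij}|)=\dfrac{|\mathbf{x}_{ij}|^2}{r^2-|\mathbf{x}_{ij}|^2+Q}$ (so $\psi(s)=s^2/(r^2-s^2+Q)$ for scalars $s$). The gradients with respect to $\mathbf{x}_i$ are $\nabla_i\psi(|\mathbf{x}_{ij}|)=\dfrac{2(r^2+Q)}{(r^2-|\mathbf{x}_{ij}|^2+Q)^2}\,\mathbf{x}_{ij}$ and $\nabla_i\psi(|\mathbf{x}^d_{ij}|)=\dfrac{2(r^2+Q)}{(r^2-|\mathbf{x}^d_{ij}|^2+Q)^2}\,\mathbf{x}^d_{ij}$. Energy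 function: $V=\frac p2\sum_{i=1}^N\sum_{j\in\mathcal{N}_i(0)}\psi(|\mathbf{x}_{ij}|)+\frac12\sum_{i=1}^N\mathbf{u}_i^{\mathsf T}\mathbf{u}_i$, where $\mathbf{u}_i=\dot{\mathbf{x}}_i$. Gradient-mismatch property with constants $\gamma,\eta>0$: on the set $\{(\mathbf{x},\dot{\mathbf{x}}):V(t)\le V(0)<p\psi(r)\}$, for every $(i,j)\in\mathcal{E}(0)$ and componentwise, $$\boldsymbol{\zeta}\big(\nabla_i\psi(|\mathbf{x}_{ij}|)-\nabla_i\psi(|\mathbf{x}^d_{ij}|)\big)\le\gamma\,\boldsymbol{\zeta}(\mathbf{x}_j-\mathbf{x}_{jd})+\eta\,\bar{x}_j\,\mathbf{1}$$ for bounded $\boldsymbol{\zeta}(\mathbf{x}_{ij})$ and $\boldsymbol{\zeta}(\mathbf{x}^d_{ij})$, where $\boldsymbol{\zeta}(\mathbf{x})=(|x_1|,\dots,|x_n|)^{\mathsf T}$, $\bar{x}_j=\|\mathbf{x}_j-\mathbf{x}_{jd}\|_\infty$ and $\mathbf{1}=(1,\dots,1)^{\mathsf T}$.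
   Formalization: The positions at negative times, which the delayed terms need when t is smaller than the delay, are left undefined in the statement; the agents are taken to be at rest before time 0, x_i(t)=x_i(0) for t≤0, since for arbitrary histories the claim can fail. *)

(* Defs.v *)
From HB Require Import structures.
From mathcomp Require Import all_boot all_order all_algebra.
From mathcomp Require Import all_classical all_reals all_analysis.

Set Implicit Arguments.
Unset Strict Implicit.
Unset Printing Implicit Defensive.

Import Order.TTheory GRing.Theory Num.Theory.
Import numFieldNormedType.Exports.

Local Open Scope classical_set_scope.
Local Open Scope ring_scope.

(* On 'cV[R]_n the norm [`|v|] is the maximum of the absolute values of the
   entries, i.e. the infinity norm; the Euclidean norm is [euclid]. *)
Definition euclid (R : realType) (n : nat) (v : 'cV[R]_n) : R :=
  Num.sqrt (\sum_k v k 0 ^+ 2).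

Definition zeta (R : realType) (n : nat) (v : 'cV[R]_n) : 'cV[R]_n :=
  map_mx (fun a => `|a|) v.

Definition psi (R : realType) (r Q s : R) : R :=
  s ^+ 2 / (r ^+ 2 - s ^+ 2 + Q).

(* The gradient of [v |-> psi r Q (euclid v)] wherever
   [euclid v ^+ 2 != r ^+ 2 + Q]; on that sphere psi has a pole, and both
   [psi] and [grad_psi] take the value 0 there because [0^-1 = 0]. *)
Definition grad_psi (R : realType) (n : nat) (r Q : R) (v : 'cV[R]_n) :
    'cV[R]_n :=
  (2 * (r ^+ 2 + Q) / (r ^+ 2 - euclid v ^+ 2 + Q) ^+ 2) *: v.

(* [d j i t] is the delay at time t on the link from agent j to agent i;
   [delayed x d j i t] is the position of j available to i at time t. *)
Definition delayed (R : realType) (N n : nat) (x : 'I_N -> R -> 'cV[R]_n)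
    (d : 'I_N -> 'I_N -> R -> R) (j i : 'I_N) (t : R) : 'cV[R]_n :=
  x j (t - d j i t).

Definition energy (R : realType) (N n : nat) (E0 : rel 'I_N) (r Q p : R)
    (x u : 'I_N -> R -> 'cV[R]_n) (t : R) : R :=
  p / 2 * (\sum_i \sum_(j | E0 i j) psi r Q (euclid (x i t - x j t)))
  + 1 / 2 * (\sum_i ((u i t)^T *m u i t) 0 0).

Definition smallest_eigenvalue (R : realType) (n : nat) (A : 'M[R]_n) (k : R) :
    Prop :=
  eigenvalue A k /\ forall a : R, eigenvalue A a -> k <= a.

(* The inequality is required only along the given motion, at the instants
   where its state lies in the sublevel set. Boundedness of the two relative
   positions is automatic at a single instant. *)
Definition gradient_mismatch (R : realType) (N n : nat) (E0 : rel 'I_N)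
    (r Q p : R) (d : 'I_N -> 'I_N -> R -> R) (x u : 'I_N -> R -> 'cV[R]_n)
    (gamma eta : R) : Prop :=
  forall t : R, 0 <= t ->
    energy E0 r Q p x u t <= energy E0 r Q p x u 0 ->
    energy E0 r Q p x u 0 < p * psi r Q r ->
  forall i j : 'I_N, E0 i j -> forall k : 'I_n,
    zeta (grad_psi r Q (x i t - x j t)
          - grad_psi r Q (x i t - delayed x d j i t)) k 0
    <= (gamma *: zeta (x j t - delayed x d j i t)
        + (eta * `|x j t - delayed x d j i t|) *: const_mx 1) k 0.

(* Main.v *)
Require Import Defs.
From HB Require Import structures.
From mathcomp Require Import all_boot all_order all_algebra.
From mathcomp Require Import all_classical all_reals all_analysis.
From mathcomp Require Import ring lra.

Set Implicit Arguments.
Unset Strict Implicit.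
Unset Printing Implicit Defensive.

Import Order.TTheory GRing.Theory Num.Theory.
Import numFieldNormedType.Exports.

Local Open Scope classical_set_scope.
Local Open Scope ring_scope.

(** Along a solution, [dV/dt] is the pairing of the velocities with the gradient
    mismatch minus the damping.  By Young's inequality and the mismatch property
    each edge contributes a multiple of [|u_i|^2] plus a multiple of the squared
    displacement of the neighbour over the delay, and Cauchy-Schwarz bounds the
    latter by a window of [F_j t = \int_0^t |u_j|^2].  Correcting [V] with the
    window integrals of the [F_j] gives [V t + \sum_i c_i F_i t <= V 0] with
    [c_i > 0], as long as [V <= V 0] and all edges are shorter than [r] on [0, t].

    These two conditions propagate by real induction.  The edge lengths remain
    strictly below [r] because [V 0 < p psi(r)].  The delicate instants are those
    with [V T = V 0]: then [F T = 0], nothing has moved so far, and a Lipschitz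
    bound on the gradients replaces the mismatch property for a short time.

    Finally the [F_i] are bounded, so [u -> 0] by Barbalat's lemma.  Since the
    derivative of [u_i] is [- p g_i] plus a vanishing term, with [g_i] the
    undelayed gradient sum, a second application gives [g_i -> 0]; pairing
    the [g_i] with positions relative to a fixed agent makes all edge lengths
    vanish. *)

(** * Real analysis *)

(** The derivative is asked for only inside the interval because the control law differentiates the
    velocities only at positive times. *)
Lemma derive_ge0_le (R : realType) (f df : R -> R) (a b : R) :
  a <= b -> (forall t, a < t < b -> is_derive t 1 f (df t)) ->
  (forall t, a < t < b -> 0 <= df t) ->
  (forall t, a <= t <= b -> {for t, continuous f}) -> f a <= f b.
Proof.
move=> ab fdf df0 fc; move: (ab); rewrite le_eqVlt => /predU1P[->//|lab].
have fdf' t : t \in `]a, b[ -> is_derive t 1 f (df t).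
  by rewrite in_itv/=; exact: fdf.
have fc' : {within `[a, b], continuous f}.
  by apply: continuous_in_subspaceT => t; rewrite inE/= in_itv/=; exact: fc.
have [c] := MVT lab fdf' fc'; rewrite in_itv/= => cab fE.
by rewrite -subr_ge0 fE mulr_ge0 ?subr_ge0// df0.
Qed.

Lemma is_derive_continuous (R : realType) (f : R -> R) (t df : R) :
  is_derive t 1 f df -> {for t, continuous f}.
Proof. by move=> [fd _]; exact/differentiable_continuous/derivable1_diffP. Qed.

Lemma is_derive_ge0_le (R : realType) (f df : R -> R) (a b : R) :
  a <= b -> (forall t, a <= t <= b -> is_derive t 1 f (df t)) ->
  (forall t, a < t < b -> 0 <= df t) -> f a <= f b.
Proof.
move=> ab fdf df0; apply: (@derive_ge0_le R f df) => // t.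
  by move=> /andP[at_ tb]; apply: fdf; rewrite !ltW.
by move=> /fdf; exact: is_derive_continuous.
Qed.

(** The supremum of the times up to which [P] holds throughout is itself such a time by the first
    two premises, and the third would push past it if [P] failed anywhere. *)
Lemma real_induction (R : realType) (P : R -> Prop) :
  P 0 -> (forall T, 0 < T -> (forall t, 0 <= t < T -> P t) -> P T) ->
  (forall T, 0 <= T -> (forall t, 0 <= t <= T -> P t) ->
     exists2 e, 0 < e & forall t, T <= t <= T + e -> P t) ->
  forall t, 0 <= t -> P t.
Proof.
move=> P0 Pclosed Popen t0 t0_ge0; apply: contrapT => nPt0.
pose A := [set T : R | 0 <= T /\ forall t, 0 <= t <= T -> P t].
have A0 : A 0 by split=> // t; rewrite -eq_le => /eqP <-.
have Aub : ubound A t0.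
  move=> T [T0 PT]; rewrite leNgt; apply/negP => tT; apply: nPt0.
  by apply: PT; rewrite t0_ge0 ltW.
have hsA : has_sup A by split; [exists 0 | exists t0].
set S := sup A.
have S0 : 0 <= S by exact: (sup_upper_bound hsA).
have PltS t : 0 <= t < S -> P t.
  move=> /andP[t_ge0 tS].
  have St0 : 0 < S - t by rewrite subr_gt0.
  have [T [_ AT] tT] := sup_adherent St0 hsA.
  by apply: AT; rewrite t_ge0 ltW// (le_lt_trans _ tT)// /S subKr.
have PS : P S by move: S0; rewrite le_eqVlt => /predU1P[<-//|/Pclosed]; exact.
have PleS t : 0 <= t <= S -> P t.
  move=> /andP[t_ge0]; rewrite le_eqVlt => /predU1P[->//|tS].
  by apply: PltS; rewrite t_ge0.
have [e e0 Pe] := Popen S S0 PleS.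
have : S + e <= S.
  apply: (sup_upper_bound hsA); split; first by rewrite addr_ge0// ltW.
  move=> t /andP[t_ge0 tSe]; have [tS|St] := leP t S.
    by apply: PleS; rewrite t_ge0.
  by apply: Pe; rewrite tSe ltW.
by rewrite gerDl leNgt e0.
Qed.

(** Since [f] vanishes on the left half-line, the integral from minus infinity is finite and gives a
    primitive on the whole line, so that delay windows may reach back before time 0. *)
Lemma primitive_vanishing (R : realType) (f : R -> R) :
  continuous f -> (forall t : R, t <= 0 -> f t = 0) ->
  exists F : R -> R, (forall t : R, is_derive t 1 F (f t)) /\
                     (forall t, t <= 0 -> F t = 0).
Proof.
move=> fc f0.
pose F t := (\int[lebesgue_measure]_(s in `]-oo, t]) f s)%R.
exists F; split=> t; last first.
  move=> t0; rewrite /F (@eq_Rintegral _ _ _ _ _ (cst 0)).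
    by rewrite Rintegral_cst//= mul0r.
  by move=> s; rewrite inE/= in_itv/= => st; apply: f0; exact: le_trans t0.
have fint : lebesgue_measure.-integrable `]-oo, (t + 1)] (EFin \o f).
  rewrite integrable_mkcond//.
  rewrite (_ : _ \_ _ = (EFin \o f) \_ `[0, t + 1]); last first.
    apply/funext => s; rewrite !patchE.
    have [s0|s0] := leP s 0.
      by rewrite /= f0//; case: ifP => _; case: ifP.
    rewrite (_ : (s \in `]-oo, (t + 1)]%classic) = (s \in `[0, (t + 1)]%classic))//.
    by rewrite !mem_setE !in_itv/= (ltW s0).
  rewrite -integrable_mkcond//.
  apply: continuous_compact_integrable; first exact: segment_compact.
  exact: continuous_subspaceT.
have [dF F'] : derivable F t 1 /\ F^`()%classic t = f t.
  apply: (@continuous_FTC1 R f -oo%O t (t + 1) _ fint _ (fc t)).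
  - by rewrite ltrDl.
  - by rewrite ltNyr.
apply: DeriveDef; first exact: dF.
by rewrite -derive1E; exact: F'.
Qed.

(* The classical Barbalat lemma is the case [e = 0]. *)
Lemma barbalat (R : realType) (f g e : R -> R) (l M : R) :
  f t @[t --> +oo] --> l -> e t @[t --> +oo] --> (0 : R) ->
  (forall t : R, 0 < t -> is_derive t 1 f (g t + e t)) ->
  (forall s t : R, 0 < s <= t -> `|g t - g s| <= M * (t - s)) ->
  g t @[t --> +oo] --> (0 : R).
Proof.
move=> fl e0 fd glip.
have M0 : 0 <= M.
  have : `|g 2 - g 1| <= M * (2 - 1) by apply: glip; lra.
  rewrite (_ : 2 - 1 = 1 :> R) ?mulr1; last by ring.
  exact: le_trans.
apply/cvgrPdist_le => eps eps0.
(* Over a step of length [h] the function [g] moves by at most [eps / 4]; the [+ 1] covers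
   [M = 0]. *)
pose h : R := Num.min 1 (eps / (4 * (M + 1))).
have h0 : 0 < h by rewrite /h lt_min ltr01/= divr_gt0// mulr_gt0//; lra.
have hM : M * h <= eps / 4.
  apply: (@le_trans _ _ ((M + 1) * (eps / (4 * (M + 1))))).
    apply: ler_pM => //; [lra|lra|by rewrite /h ge_min lexx orbT].
  rewrite le_eqVlt; apply/orP; left; apply/eqP; field; lra.
(* Two values of [f] this close to the limit differ by at most [h * (eps / 4)]. The increment of [f]
   over the step also lies within [h * (eps / 2)] of [h * g t], by comparison with affine functions,
   and together these bound [g t] by [eps]. *)
move/cvgrPdist_le : fl => /(_ (h * (eps / 8))) /(_ _)[|A [_ fA]].
  by rewrite mulr_gt0// divr_gt0.
move/cvgrPdist_le : e0 => /(_ (eps / 4)) /(_ _)[|B [_ eB]].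
  by rewrite divr_gt0.
exists (Num.max 1 (Num.max A B)); split; first exact: num_real.
move=> t; rewrite !gt_max => /and3P[t1 At Bt].
have fclose : `|f (t + h) - f t| <= h * (eps / 4).
  have -> : f (t + h) - f t = (l - f t) - (l - f (t + h)) by ring.
  apply: le_trans (ler_normB _ _) _.
  have -> : h * (eps / 4) = h * (eps / 8) + h * (eps / 8) by field.
  by apply: lerD; apply: fA => //; rewrite ltr_wpDr// ltW.
have dfd s : t <= s <= t + h -> is_derive s 1 f (g s + e s).
  by move=> /andP[ts _]; apply: fd; lra.
have near_g s : t < s < t + h -> `|g s + e s - g t| <= eps / 2.
  move=> /andP[ts sth].
  have -> : g s + e s - g t = (g s - g t) + e s by ring.
  apply: le_trans (ler_normD _ _) _.
  have -> : eps / 2 = eps / 4 + eps / 4 by field.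
  apply: lerD.
    apply: le_trans (glip _ _ _) _; first lra.
    by apply: le_trans hM; apply: ler_wpM2l => //; lra.
  have := eB s; rewrite /= sub0r normrN; apply; exact: lt_trans ts.
have lin_d (c s : R) : is_derive s 1 (fun v : R => c * v) c.
  have := is_deriveZ c (is_derive_id s (1 : R)).
  by move=> H; apply: is_derive_eq H _; rewrite /GRing.scale/= mulr1.
rewrite /= sub0r normrN ler_norml.
have up : h * (g t - eps / 2) <= f (t + h) - f t.
  have : f t - (g t - eps / 2) * t
         <= f (t + h) - (g t - eps / 2) * (t + h).
    apply: (@is_derive_ge0_le R (fun v => f v - (g t - eps / 2) * v)
              (fun s => g s + e s - (g t - eps / 2))).
    - lra.
    - by move=> s /dfd ds; exact: is_deriveB.
    - by move=> s /near_g; rewrite ler_norml => /andP[]; lra.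
  rewrite -subr_ge0 => H; rewrite -subr_ge0; move: H; congr (_ <= _); ring.
have dn : f (t + h) - f t <= h * (g t + eps / 2).
  have : (g t + eps / 2) * t - f t
         <= (g t + eps / 2) * (t + h) - f (t + h).
    apply: (@is_derive_ge0_le R (fun v => (g t + eps / 2) * v - f v)
              (fun s => (g t + eps / 2) - (g s + e s))).
    - lra.
    - by move=> s /dfd ds; exact: is_deriveB.
    - by move=> s /near_g; rewrite ler_norml => /andP[]; lra.
  rewrite -subr_ge0 => H; rewrite -subr_ge0; move: H; congr (_ <= _); ring.
move: fclose; rewrite ler_norml => /andP[fc1 fc2].
have h1 : h * (g t - eps / 2) <= h * (eps / 4) by exact: le_trans fc2.
have h2 : h * - (eps / 4) <= h * (g t + eps / 2).
  by rewrite mulrN; exact: le_trans dn.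
by move: h1 h2; rewrite !ler_pM2l//; lra.
Qed.

Lemma connect_ind_step (T : finType) (e : rel T) (P : T -> T -> Prop) :
  (forall x, P x x) -> (forall x y z, e x y -> P y z -> P x z) ->
  forall x y, connect e x y -> P x y.
Proof.
move=> Pxx Pe x y /connectP[s]; elim: s x => [x _ ->//|z s IH x /= /andP[exz zs] yE].
by apply: Pe exz _; exact: IH.
Qed.

Lemma cvg_sumf (R : realType) (T : Type) (F : set_system T) (I : Type)
    (s : seq I) (P : pred I) (f : I -> T -> R) (l : I -> R) : Filter F ->
  (forall i, P i -> f i x @[x --> F] --> l i) ->
  \sum_(i <- s | P i) f i x @[x --> F] --> \sum_(i <- s | P i) l i.
Proof.
move=> FF fl; rewrite (_ : (fun _ => _) = \sum_(i <- s | P i) f i); last first.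
  by apply/funext => v; rewrite fct_sumE.
by elim/big_ind2 : _ => //; [exact: cvg_cst|move=> *; exact: cvgD].
Qed.

Lemma cvg_mulcf (R : realType) (T : Type) (F : set_system T) (c l : R)
    (f : T -> R) : Filter F ->
  f x @[x --> F] --> l -> c * f x @[x --> F] --> c * l.
Proof. by move=> FF fl; apply: cvgM => //; exact: cvg_cst. Qed.

(** * Differentiation rules for functions of a real variable *)

Section ScalarDerivatives.
Context {R : realType}.
Implicit Types (f g : R -> R) (t c a df dg : R).

Lemma is_derive_addf f g t df dg : is_derive t 1 f df -> is_derive t 1 g dg ->
  is_derive t 1 (fun s => f s + g s) (df + dg).
Proof. exact: is_deriveD. Qed.

Lemma is_derive_subf f g t df dg : is_derive t 1 f df -> is_derive t 1 g dg ->
  is_derive t 1 (fun s => f s - g s) (df - dg).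
Proof. exact: is_deriveB. Qed.

Lemma is_derive_mulf f g t df dg : is_derive t 1 f df -> is_derive t 1 g dg ->
  is_derive t 1 (fun s => f s * g s) (f t * dg + g t * df).
Proof. exact: is_deriveM. Qed.

Lemma is_derive_mulcf c f t df : is_derive t 1 f df ->
  is_derive t 1 (fun s => c * f s) (c * df).
Proof. exact: is_deriveZ. Qed.

Lemma is_derive_mulc c t : is_derive t 1 (fun s => c * s) c.
Proof.
have := is_derive_mulcf c (is_derive_id t 1) => H.
by apply: is_derive_eq H _; rewrite mulr1.
Qed.

Lemma is_derive_sqrf f t df : is_derive t 1 f df ->
  is_derive t 1 (fun s => f s ^+ 2) (2 * (f t * df)).
Proof.
move=> fd; have := is_derive_mulf fd fd => H; apply: is_derive_eq H _; ring.
Qed.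

Lemma is_derive_sumf (I : Type) (s : seq I) (P : pred I) (f : I -> R -> R)
    (df : I -> R) t :
  (forall i, P i -> is_derive t 1 (f i) (df i)) ->
  is_derive t 1 (fun v => \sum_(i <- s | P i) f i v) (\sum_(i <- s | P i) df i).
Proof.
move=> fd; rewrite (_ : (fun _ => _) = \sum_(i <- s | P i) f i); last first.
  by apply/funext => v; rewrite fct_sumE.
by elim/big_ind2 : _ => //; [exact: is_derive_cst|move=> *; exact: is_deriveD].
Qed.

Lemma is_derive_translate f c t df : is_derive (t - c) 1 f df ->
  is_derive t 1 (fun s => f (s - c)) df.
Proof.
move=> fd; have cd : is_derive t 1 (fun s : R => s - c) 1.
  have := is_derive_subf (is_derive_id t (1 : R)) (is_derive_cst c t (1 : R)).
  by move=> H; apply: is_derive_eq H _; rewrite subr0.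
have := @is_derive1_comp R f (fun s => s - c) t _ _ fd cd.
by move=> H; apply: is_derive_eq H _; rewrite mulr1.
Qed.

Lemma is_derive_invf f t df : f t != 0 -> is_derive t 1 f df ->
  is_derive t 1 (fun s => (f s)^-1) (- (f t) ^- 2 * df).
Proof.
move=> nz [fd fE]; apply: DeriveDef; first exact: derivableV.
by have := deriveV nz fd; rewrite fE.
Qed.

(** With [a] for [r ^+ 2 + Q] and [f] the squared length of an edge, this differentiates the
    potential of that edge; the strict bound keeps it off the pole. *)
Lemma is_derive_pot f t df a : f t < a -> is_derive t 1 f df ->
  is_derive t 1 (fun s => f s / (a - f s)) (a / (a - f t) ^+ 2 * df).
Proof.
move=> fa fd; have nz : a - f t != 0 by rewrite subr_eq0 gt_eqF.
have gd : is_derive t 1 (fun s => a - f s) (0 - df).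
  exact: is_derive_subf (is_derive_cst a t 1) fd.
have vd := @is_derive_invf (fun s => a - f s) t _ nz gd.
apply: is_derive_eq (is_derive_mulf fd vd) _; field; exact: nz.
Qed.

End ScalarDerivatives.

Lemma sum_edge_swap (R : nmodType) (N : nat) (E : rel 'I_N)
    (h : 'I_N -> 'I_N -> R) : symmetric E ->
  \sum_i \sum_(j | E i j) h i j = \sum_i \sum_(j | E i j) h j i.
Proof.
move=> Esym; rewrite (exchange_big_dep xpredT)//=.
by apply: eq_bigr => i _; apply: eq_bigl => j; rewrite Esym.
Qed.

(** * Displacements and window integrals of the accumulated squared speed *)

Section VectorPrimitive.
Context {R : realType} {n : nat}.
Variables (x u : 'I_n -> R -> R) (F : R -> R).
Hypothesis dx : forall k (t : R), is_derive t 1 (x k) (u k t).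
Hypothesis dF : forall (t : R), is_derive t 1 F (\sum_k u k t ^+ 2).

Lemma energy_primitive_nd (s t : R) : s <= t -> F s <= F t.
Proof.
move=> st; apply: (is_derive_ge0_le st (fun v _ => dF v)) => v _.
by apply: sumr_ge0 => k _; exact: sqr_ge0.
Qed.

(* Cauchy-Schwarz in integral-free form: [sum_k (u_k - c_k)^2 >= 0] says that
   [F - 2 c x + |c|^2 id] is nondecreasing, for the mean velocity c. *)
Lemma displacement_sqr_le (s t : R) : s <= t ->
  \sum_k (x k t - x k s) ^+ 2 <= (t - s) * (F t - F s).
Proof.
rewrite le_eqVlt => /predU1P[->|st].
  rewrite subrr mul0r big1// => k _; rewrite subrr expr0n//.
pose c k := (x k t - x k s) / (t - s).
pose L v := F v - 2 * (\sum_k c k * x k v) + (\sum_k c k ^+ 2) * v.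
have : L s <= L t.
  apply: (@is_derive_ge0_le R L (fun v => \sum_k u k v ^+ 2
      - 2 * (\sum_k c k * u k v) + \sum_k c k ^+ 2)); first exact: ltW.
    move=> v _; apply: is_derive_addf (is_derive_mulc _ _).
    apply: is_derive_subf (dF v) (is_derive_mulcf 2 _).
    by apply: is_derive_sumf => k _; exact: is_derive_mulcf.
  move=> v _; rewrite mulr_sumr -sumrB -big_split/= sumr_ge0// => k _.
  by rewrite (_ : _ + _ = (u k v - c k) ^+ 2) ?sqr_ge0//; ring.
have st0 : 0 < t - s by rewrite subr_gt0.
have sumE : \sum_k (x k t - x k s) ^+ 2 = (t - s) ^+ 2 * \sum_k c k ^+ 2.
  rewrite mulr_sumr; apply: eq_bigr => k _; rewrite /c; field.
  by rewrite gt_eqF.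
have cxE : \sum_k c k * x k t - \sum_k c k * x k s
           = (t - s) * \sum_k c k ^+ 2.
  rewrite -sumrB mulr_sumr; apply: eq_bigr => k _; rewrite /c; field.
  by rewrite gt_eqF.
rewrite /L -subr_ge0 => L0.
rewrite sumE expr2 -mulrA ler_pM2l//.
have -> : (t - s) * \sum_k c k ^+ 2
  = 2 * (\sum_k c k * x k t - \sum_k c k * x k s) - (t - s) * \sum_k c k ^+ 2.
  by rewrite cxE; ring.
rewrite -subr_ge0; move: L0; congr (_ <= _); ring.
Qed.

(** The actual delay may be irregular in time. Widening the window to the bound [D], which the
    monotonicity of [F] permits, leaves a right-hand side that is the derivative of a window
    integral up to the factor [D]. *)
Lemma delayed_displacement_le (s t D : R) : t - D <= s <= t ->
  \sum_k (x k t - x k s) ^+ 2 <= D * (F t - F (t - D)).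
Proof.
move=> /andP[tDs st]; apply: le_trans (displacement_sqr_le st) _.
have F1 := energy_primitive_nd st; have F2 := energy_primitive_nd tDs.
apply: ler_pM; lra.
Qed.

Variable Phi : R -> R.
Hypothesis dPhi : forall (t : R), is_derive t 1 Phi (F t).
Hypothesis F_ge0 : forall (t : R), 0 <= F t.

(** The middle term is the integral of [F] over a window of length [D], and [F] is nonnegative and
    nondecreasing. *)
Lemma window_primitive_le (t D : R) : 0 <= D ->
  0 <= Phi t - Phi (t - D) <= D * F t.
Proof.
move=> D0; rewrite subr_ge0; apply/andP; split.
  by apply: (@is_derive_ge0_le R Phi F) => //; lra.
have : F t * (t - D) - Phi (t - D) <= F t * t - Phi t.
  apply: (@is_derive_ge0_le R (fun v => F t * v - Phi v)
            (fun v => F t - F v)); first lra.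
    move=> v _; apply: is_derive_subf (dPhi v).
    exact: is_derive_mulc.
  move=> v /andP[_ /ltW vt]; rewrite subr_ge0.
  exact: energy_primitive_nd.
lra.
Qed.

End VectorPrimitive.

(** * The scalar system *)

Definition dist2 (R : realType) (N n : nat) (X : 'I_N -> 'I_n -> R -> R)
  (i j : 'I_N) (t : R) : R := \sum_k (X i k t - X j k t) ^+ 2.

(* [gcoef a q] is the scalar factor of [grad_psi] at squared distance [q], with
   [a] standing for [r ^+ 2 + Q]. *)
Definition gcoef (R : realType) (a q : R) : R := 2 * a / (a - q) ^+ 2.

(** The energy in coordinates. In terms of squared lengths the potential is a rational function, so
    the Euclidean norm itself is never differentiated. *)
Definition lyap (R : realType) (N n : nat) (E : rel 'I_N) (a p : R)
    (X U : 'I_N -> 'I_n -> R -> R) (t : R) : R :=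
  p / 2 * (\sum_i \sum_(j | E i j) dist2 X i j t / (a - dist2 X i j t))
  + 1 / 2 * (\sum_i \sum_k U i k t ^+ 2).

(** * The dissipation inequality over a time interval *)

Section Dissipation.
Context {R : realType} {N n : nat}.
Variables (E : rel 'I_N) (a p : R) (X U : 'I_N -> 'I_n -> R -> R).
Hypothesis Esym : symmetric E.
Hypothesis p_gt0 : 0 < p.
Hypothesis dX : forall i k (t : R), is_derive t 1 (X i k) (U i k t).

Lemma is_derive_dist2 (i j : 'I_N) (t : R) : is_derive t 1 (dist2 X i j)
  (\sum_k 2 * ((X i k t - X j k t) * (U i k t - U j k t))).
Proof.
apply: is_derive_sumf => k _.
exact: is_derive_sqrf (is_derive_subf (dX i k t) (dX j k t)).
Qed.

(** The coefficient is symmetric and the relative position antisymmetric in the endpoints, so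
    exchanging them turns the [U j] part into the [U i] part. Here [U] is arbitrary: velocities at
    first, later positions relative to a fixed agent. *)
Lemma sum_coupling (t : R) :
  \sum_i \sum_(j | E i j) gcoef a (dist2 X i j t) *
     (\sum_k (X i k t - X j k t) * (U i k t - U j k t)) =
  2 * \sum_i \sum_(j | E i j) \sum_k
     gcoef a (dist2 X i j t) * (X i k t - X j k t) * U i k t.
Proof.
have dist2C i j : dist2 X j i t = dist2 X i j t.
  by apply: eq_bigr => k _; rewrite -[in LHS]opprB sqrrN.
pose h i j := \sum_k gcoef a (dist2 X i j t) * (X i k t - X j k t) * U i k t.
rewrite (_ : _ * _ = \sum_i \sum_(j | E i j) h i j
                   + \sum_i \sum_(j | E i j) h j i); last first.
  by rewrite -(sum_edge_swap h Esym); rewrite mulr_natl mulr2n.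
rewrite -big_split/=; apply: eq_bigr => i _; rewrite -big_split/=.
apply: eq_bigr => j _; rewrite /h dist2C -big_split mulr_sumr/=.
by apply: eq_bigr => k _; ring.
Qed.

Lemma is_derive_lyap (U' : 'I_N -> 'I_n -> R) (t : R) :
  (forall i j, E i j -> dist2 X i j t < a) ->
  (forall i k, is_derive t 1 (U i k) (U' i k)) ->
  is_derive t 1 (lyap E a p X U)
    (p * (\sum_i \sum_(j | E i j) \sum_k
            gcoef a (dist2 X i j t) * (X i k t - X j k t) * U i k t)
     + \sum_i \sum_k U i k t * U' i k).
Proof.
move=> qa dU.
have dpot : is_derive t 1 (fun s => \sum_i \sum_(j | E i j)
      dist2 X i j s / (a - dist2 X i j s))
    (\sum_i \sum_(j | E i j) a / (a - dist2 X i j t) ^+ 2 *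
      (\sum_k 2 * ((X i k t - X j k t) * (U i k t - U j k t)))).
  apply: is_derive_sumf => i _; apply: is_derive_sumf => j Eij.
  exact: is_derive_pot (qa i j Eij) (is_derive_dist2 i j t).
have dkin : is_derive t 1 (fun s => \sum_i \sum_k U i k s ^+ 2)
    (\sum_i \sum_k 2 * (U i k t * U' i k)).
  apply: is_derive_sumf => i _; apply: is_derive_sumf => k _.
  exact: is_derive_sqrf (dU i k).
apply: is_derive_eq
  (is_derive_addf (is_derive_mulcf (p / 2) dpot) (is_derive_mulcf (1 / 2) dkin)) _.
congr (_ + _).
  rewrite -[p in RHS](@divfK _ 2)// -[RHS]mulrA -sum_coupling; congr (_ * _).
  apply: eq_bigr => i _; apply: eq_bigr => j _; rewrite /gcoef !mulr_sumr.
  apply: eq_bigr => k _; ring.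
rewrite mulr_sumr; apply: eq_bigr => i _; rewrite mulr_sumr.
by apply: eq_bigr => k _; field.
Qed.

Lemma continuous_lyap (t : R) :
  (forall i j, E i j -> dist2 X i j t < a) ->
  (forall i k, {for t, continuous (U i k)}) ->
  {for t, continuous (lyap E a p X U)}.
Proof.
move=> qa cU; apply: cvgD; apply: cvg_mulcf.
  apply: cvg_sumf => i _; apply: cvg_sumf => j Eij.
  exact: is_derive_continuous (is_derive_pot (qa i j Eij) (is_derive_dist2 i j t)).
apply: cvg_sumf => i _; apply: cvg_sumf => k _.
by rewrite expr2; apply: cvgM; exact: cU.
Qed.

(** Young's inequality with weight [al] is applied separately to the two terms of the mismatch
    bound. The second term is the same for every coordinate, so the sum over coordinates puts the
    factor [n] in front of [e]. *)
Lemma mismatch_young (al g e : R) (u dl w : 'I_n -> R) :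
  0 < al -> 0 <= g -> 0 <= e ->
  (forall k, `|w k| <= g * `|dl k| + e * Num.sqrt (\sum_k dl k ^+ 2)) ->
  \sum_k u k * w k <= al * (g + e) / 2 * (\sum_k u k ^+ 2)
     + (g + n%:R * e) / (2 * al) * (\sum_k dl k ^+ 2).
Proof.
move=> al0 g0 e0 wle; set W := \sum_k dl k ^+ 2.
have W0 : 0 <= W by apply: sumr_ge0 => k _; exact: sqr_ge0.
have young (y z : R) : `|y| * `|z| <= al / 2 * y ^+ 2 + z ^+ 2 / (2 * al).
  rewrite -(real_normK (num_real y)) -(real_normK (num_real z)) -subr_ge0.
  rewrite (_ : _ - _ = (al * `|y| - `|z|) ^+ 2 / (2 * al)).
    by rewrite divr_ge0 ?sqr_ge0// mulr_ge0// ltW.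
  by field; rewrite gt_eqF.
apply: (@le_trans _ _ (\sum_k (g * (al / 2 * u k ^+ 2 + dl k ^+ 2 / (2 * al))
    + e * (al / 2 * u k ^+ 2 + W / (2 * al))))).
  apply: ler_sum => k _; apply: le_trans (ler_norm _) _; rewrite normrM.
  apply: le_trans (ler_wpM2l (normr_ge0 _) (wle k)) _.
  rewrite mulrDr; apply: lerD; rewrite mulrCA; apply: ler_wpM2l => //.
  have := young (u k) (Num.sqrt W).
  by rewrite (ger0_norm (sqrtr_ge0 W)) sqr_sqrtr.
rewrite big_split/= -!mulr_sumr !big_split/= -!mulr_sumr -!mulr_suml -/W.
rewrite sumr_const card_ord -[_^-1 *+ n]mulr_natl le_eqVlt; apply/orP; left.
by apply/eqP; field; rewrite gt_eqF.
Qed.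

Variables (Y : 'I_N -> 'I_N -> 'I_n -> R -> R) (kap : 'I_N -> 'I_n -> R).
Variables (kmin : 'I_N -> R) (al D : 'I_N -> 'I_N -> R) (g e : R).
Variables (F Phi : 'I_N -> R -> R) (T0 T : R).
Hypothesis T0T : T0 <= T.
Hypothesis qa : forall i j (t : R), E i j -> T0 <= t <= T -> dist2 X i j t < a.
Hypothesis cU : forall i k, continuous (U i k).
Hypothesis dU : forall i k (t : R), T0 < t < T -> is_derive t 1 (U i k)
  (- (p * \sum_(j | E i j) gcoef a (\sum_l (X i l t - Y i j l t) ^+ 2)
                           * (X i k t - Y i j k t)) - kap i k * U i k t).
Hypothesis kminP : forall i k, kmin i <= kap i k.
Hypothesis al_gt0 : forall i j, E i j -> 0 < al i j.
Hypothesis D_ge0 : forall i j, E i j -> 0 <= D i j.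
Hypothesis g_ge0 : 0 <= g.
Hypothesis e_ge0 : 0 <= e.
Hypothesis mm : forall i j k (t : R), E i j -> T0 < t < T ->
  `|gcoef a (dist2 X i j t) * (X i k t - X j k t)
    - gcoef a (\sum_l (X i l t - Y i j l t) ^+ 2) * (X i k t - Y i j k t)|
  <= g * `|X j k t - Y i j k t|
     + e * Num.sqrt (\sum_l (X j l t - Y i j l t) ^+ 2).
Hypothesis YP : forall i j (t : R), E i j -> T0 < t < T ->
  exists2 s, t - D i j <= s <= t & forall k, Y i j k t = X j k s.
Hypothesis dF : forall i (t : R), is_derive t 1 (F i) (\sum_k U i k t ^+ 2).
Hypothesis dPhi : forall i (t : R), is_derive t 1 (Phi i) (F i t).
Hypothesis F_ge0 : forall i (t : R), 0 <= F i t.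
Hypothesis FT0 : forall i, F i T0 = 0.

(** Young coefficients of an edge: [A] goes with the speed of the receiver [i], [B] with the
    displacement of the sender [j] during the delay. *)
Let A i j := p * (al i j * (g + e) / 2).
Let B i j := p * ((g + n%:R * e) / (2 * al i j)).

(* Lyapunov-Krasovskii functional (up to sign): the window integrals
   [Phi_j t - Phi_j (t - D)] absorb the delay terms. *)
Let L t := \sum_i (\sum_(j | E i j)
      (A i j * F i t + B i j * D i j * (Phi j t - Phi j (t - D i j)))
      - kmin i * F i t) - lyap E a p X U t.

Let B_ge0 i j : E i j -> 0 <= B i j.
Proof.
move=> Eij; have := al_gt0 Eij => al0.
by rewrite mulr_ge0 ?(ltW p_gt0)// divr_ge0 ?addr_ge0 ?mulr_ge0// ltW.
Qed.

(** Differentiating the window integral of [F j] gives the very increment of [F j] that bounds the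
    delayed displacement by Cauchy-Schwarz, so the derivative of the correction dominates that of
    the energy edge by edge. *)
Let L_nd : L T0 <= L T.
Proof.
pose dV t := p * (\sum_i \sum_(j | E i j) \sum_k
      gcoef a (dist2 X i j t) * (X i k t - X j k t) * U i k t)
  + \sum_i \sum_k U i k t * (- (p * \sum_(j | E i j)
      gcoef a (\sum_l (X i l t - Y i j l t) ^+ 2)
        * (X i k t - Y i j k t)) - kap i k * U i k t).
apply: (@derive_ge0_le R L (fun t => \sum_i (\sum_(j | E i j)
      (A i j * (\sum_k U i k t ^+ 2)
       + B i j * D i j * (F j t - F j (t - D i j)))
      - kmin i * (\sum_k U i k t ^+ 2)) - dV t)) => //.
- move=> t tT.
  have dVt : is_derive t 1 (lyap E a p X U) (dV t).
    apply: is_derive_lyap => [i j Eij|i k]; last exact: dU.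
    by apply: qa => //; move: tT => /andP[/ltW-> /ltW->].
  refine (is_derive_subf _ dVt).
  apply: is_derive_sumf => i _.
  refine (is_derive_subf _ (is_derive_mulcf (kmin i) (dF i t))).
  apply: is_derive_sumf => j Eij.
  refine (is_derive_addf (is_derive_mulcf (A i j) (dF i t)) _).
  refine (is_derive_mulcf _ (is_derive_subf (dPhi j t) _)).
  exact: is_derive_translate (dPhi j (t - D i j)).
- move=> t tT; rewrite subr_ge0.
  (* The undelayed gradients from the potential and the delayed ones from the control law combine
     into the gradient mismatch. *)
  rewrite (_ : dV t = \sum_i (\sum_(j | E i j) p * (\sum_k U i k t *
       (gcoef a (dist2 X i j t) * (X i k t - X j k t)
        - gcoef a (\sum_l (X i l t - Y i j l t) ^+ 2) * (X i k t - Y i j k t)))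
       - \sum_k kap i k * U i k t ^+ 2)); last first.
    rewrite /dV mulr_sumr -big_split; apply: eq_bigr => i _ /=.
    rewrite mulr_sumr.
    rewrite (eq_bigr (fun k => - (\sum_(j | E i j) p * (U i k t *
       (gcoef a (\sum_l (X i l t - Y i j l t) ^+ 2) * (X i k t - Y i j k t))))
       - kap i k * U i k t ^+ 2)); last first.
      move=> k _; rewrite mulrBr mulrN mulrCA !mulr_sumr.
      by congr (_ - _); ring.
    rewrite sumrB addrA; congr (_ - _).
    rewrite sumrN exchange_big/= -sumrB; apply: eq_bigr => j _.
    rewrite -mulr_sumr -mulrBr -sumrB; congr (_ * _); apply: eq_bigr => k _.
    ring.
  apply: ler_sum => i _; apply: lerB; last first.
    by rewrite mulr_sumr; apply: ler_sum => k _; rewrite ler_wpM2r ?sqr_ge0.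
  apply: ler_sum => j Eij.
  have [s ts Ys] := YP Eij tT.
  apply: (@le_trans _ _ (A i j * (\sum_k U i k t ^+ 2)
      + B i j * (\sum_k (X j k t - Y i j k t) ^+ 2))).
    rewrite /A /B -!mulrA -mulrDr ler_pM2l// !mulrA.
    apply: mismatch_young => // [|k]; [exact: al_gt0|exact: mm].
  rewrite lerD2l -mulrA; apply: ler_wpM2l; first exact: B_ge0.
  have := delayed_displacement_le (dX j) (dF j) ts.
  by under eq_bigr do rewrite -Ys.
- move=> t tT; apply: cvgB.
    apply: cvg_sumf => i _; apply: cvgB; last first.
      by apply: cvg_mulcf; exact: is_derive_continuous (dF i t).
    apply: cvg_sumf => j Eij; apply: cvgD; apply: cvg_mulcf.
      exact: is_derive_continuous (dF i t).
    have := is_derive_subf (dPhi j t) (is_derive_translate (dPhi j (t - D i j))).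
    exact: is_derive_continuous.
  by apply: continuous_lyap => [i j Eij|i k]; [exact: qa|exact: cU].
Qed.

(** At [T0] the correction terms are nonnegative, and at [T] each window integral is at most
    [D i j * F j T]. Exchanging the endpoints of the edges collects the terms in [F i], whence the
    transposed indices [D j i] and [al j i]. The start [T0] is left free so that the bound can also
    begin at any instant up to which nothing has moved. *)
Lemma dissipation :
  lyap E a p X U T + \sum_i (kmin i - \sum_(j | E i j)
     (al i j * p * (g + e) / 2
      + p * (g + n%:R * e) * D j i ^+ 2 / (2 * al j i))) * F i T
  <= lyap E a p X U T0.
Proof.
have win i j t : E i j -> 0 <= Phi j t - Phi j (t - D i j) <= D i j * F j t.
  by move=> /D_ge0; exact: (window_primitive_le (dF j) (dPhi j) (F_ge0 j)).
have LT0 : - lyap E a p X U T0 <= L T0.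
  rewrite /L lerDr; apply: sumr_ge0 => i _.
  rewrite FT0 mulr0 subr0; apply: sumr_ge0 => j Eij.
  rewrite mulr0 add0r; have /andP[win0 _] := win i j T0 Eij.
  by apply: mulr_ge0 win0; apply: mulr_ge0; [exact: B_ge0|exact: D_ge0].
have LT : L T <= \sum_i (\sum_(j | E i j)
    (al i j * p * (g + e) / 2
      + p * (g + n%:R * e) * D j i ^+ 2 / (2 * al j i)) - kmin i) * F i T
    - lyap E a p X U T.
  rewrite lerD2r; apply: (@le_trans _ _ (\sum_i (\sum_(j | E i j)
     (A i j * F i T + B i j * D i j ^+ 2 * F j T) - kmin i * F i T))).
    apply: ler_sum => i _; rewrite lerD2r; apply: ler_sum => j Eij.
    have /andP[_ winT] := win i j T Eij.
    rewrite lerD2l (_ : B i j * _ ^+ 2 * _ = B i j * D i j * (D i j * F j T)); last by ring.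
    by apply: ler_wpM2l winT; apply: mulr_ge0; [exact: B_ge0|exact: D_ge0].
  rewrite sumrB.
  under eq_bigr do rewrite big_split/=.
  rewrite big_split/= (sum_edge_swap (fun i j => B i j * D i j ^+ 2 * F j T) Esym).
  rewrite -big_split -sumrB/= le_eqVlt; apply/orP; left; apply/eqP.
  apply: eq_bigr => i _; rewrite -big_split mulrBl mulr_suml/=; congr (_ - _).
  apply: eq_bigr => j Eij; rewrite /A /B; field.
  by rewrite gt_eqF// al_gt0// Esym.
have := le_trans LT0 (le_trans L_nd LT).
rewrite (eq_bigr (fun i => - ((kmin i - \sum_(j | E i j)
     (al i j * p * (g + e) / 2
      + p * (g + n%:R * e) * D j i ^+ 2 / (2 * al j i))) * F i T))).
  rewrite sumrN; lra.
by move=> i _; rewrite -mulNr opprB.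
Qed.

End Dissipation.

(** * Lipschitz bounds for the gradient, and auxiliary estimates and limits *)

Lemma coord_le_sqrt (R : realType) (n : nat) (v : 'I_n -> R) (k : 'I_n) :
  `|v k| <= Num.sqrt (\sum_l v l ^+ 2).
Proof.
rewrite -sqrtr_sqr ler_wsqrtr// (bigD1 k)//= lerDl.
by apply: sumr_ge0 => l _; exact: sqr_ge0.
Qed.

Lemma gcoef_bound (R : realType) (a b q : R) : 0 <= q <= b -> b < a ->
  0 <= gcoef a q <= 2 * a / (a - b) ^+ 2.
Proof.
move=> /andP[q0 qb] ba; have a0 : 0 <= 2 * a by lra.
rewrite /gcoef divr_ge0 ?sqr_ge0//= ler_wpM2l// lef_pV2 ?posrE; last 2 first.
- by rewrite exprn_gt0//; lra.
- by rewrite exprn_gt0//; lra.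
by rewrite ler_sqr ?nnegrE; lra.
Qed.

(** Squared lengths up to [b < a] stay away from the pole. The difference splits into a change of
    the vector and a change of the coefficient, the latter controlled through the difference of the
    squared lengths. *)
Lemma gcoef_lipschitz (R : realType) (n : nat) (a b : R) : 0 <= b < a ->
  exists2 L : R, 0 <= L & forall v w : 'I_n -> R,
    \sum_l v l ^+ 2 <= b -> \sum_l w l ^+ 2 <= b -> forall k,
    `|gcoef a (\sum_l v l ^+ 2) * v k - gcoef a (\sum_l w l ^+ 2) * w k|
      <= L * Num.sqrt (\sum_l (v l - w l) ^+ 2).
Proof.
move=> /andP[b0 ba]; have a0 : 0 < a by lra.
pose c := a - b; have c0 : 0 < c by rewrite subr_gt0.
have c2 : 0 < c ^+ 2 by rewrite exprn_gt0.
(* [L1] bounds the coefficient on [[0, b]], and [L2] is a Lipschitz constant for it there. *)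
pose L1 := 2 * a / c ^+ 2; pose L2 := 4 * a ^+ 2 / (c ^+ 2 * c ^+ 2).
have L10 : 0 <= L1 by apply: divr_ge0; lra.
have L20 : 0 <= L2.
  by apply: divr_ge0; [have := sqr_ge0 a; lra|rewrite mulr_ge0// ltW].
have sb0 := sqrtr_ge0 b.
exists (L1 + L2 * (n%:R * (2 * Num.sqrt b)) * Num.sqrt b).
  apply: addr_ge0 L10 (mulr_ge0 (mulr_ge0 L20 _) sb0).
  exact: mulr_ge0 (ler0n _ _) (mulr_ge0 (ler0n _ 2) sb0).
move=> v w; set qv := \sum_l v l ^+ 2; set qw := \sum_l w l ^+ 2 => vb wb k.
have qv0 : 0 <= qv by apply: sumr_ge0 => l _; exact: sqr_ge0.
have qw0 : 0 <= qw by apply: sumr_ge0 => l _; exact: sqr_ge0.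
have vk l : `|v l| <= Num.sqrt b.
  by apply: le_trans (coord_le_sqrt v l) _; rewrite ler_wsqrtr.
have wk l : `|w l| <= Num.sqrt b.
  by apply: le_trans (coord_le_sqrt w l) _; rewrite ler_wsqrtr.
set S := Num.sqrt (\sum_l (v l - w l) ^+ 2); have S0 : 0 <= S by exact: sqrtr_ge0.
have dk l : `|v l - w l| <= S by exact: (coord_le_sqrt (fun l => v l - w l)).
have gv : `|gcoef a qv| <= L1.
  have /andP[? ?] : 0 <= gcoef a qv <= L1 by apply: gcoef_bound; rewrite ?qv0.
  by rewrite ger0_norm.
have dq : `|qv - qw| <= n%:R * (2 * Num.sqrt b) * S.
  rewrite -sumrB; apply: le_trans (ler_norm_sum _ _ _) _.
  apply: (@le_trans _ _ (\sum_(i < n) 2 * Num.sqrt b * S)).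
    apply: ler_sum => l _; rewrite subr_sqr normrM mulrC.
    apply: ler_pM => //; apply: le_trans (ler_normD _ _) _.
    by have := vk l; have := wk l; lra.
  by rewrite sumr_const card_ord -[leLHS]mulr_natl !mulrA.
have dg : `|gcoef a qv - gcoef a qw| <= L2 * `|qv - qw|.
  have nv : a - qv != 0 by rewrite gt_eqF//; lra.
  have nw : a - qw != 0 by rewrite gt_eqF//; lra.
  have -> : gcoef a qv - gcoef a qw
    = 2 * a * (2 * a - qv - qw) / ((a - qv) ^+ 2 * (a - qw) ^+ 2) * (qv - qw).
    by rewrite /gcoef; field; rewrite nv nw.
  rewrite normrM ler_wpM2r// ger0_norm; last first.
    apply: divr_ge0; last exact: mulr_ge0 (sqr_ge0 _) (sqr_ge0 _).
    by apply: mulr_ge0; lra.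
  rewrite /L2; apply: ler_pM.
  - by rewrite mulr_ge0//; lra.
  - by rewrite invr_ge0 mulr_ge0 ?sqr_ge0.
  - rewrite (_ : 4 * a ^+ 2 = 2 * a * (2 * a)); last by ring.
    by apply: ler_wpM2l; lra.
  - have cv : c ^+ 2 <= (a - qv) ^+ 2 by rewrite ler_sqr ?nnegrE /c; lra.
    have cw : c ^+ 2 <= (a - qw) ^+ 2 by rewrite ler_sqr ?nnegrE /c; lra.
    have cv0 := lt_le_trans c2 cv; have cw0 := lt_le_trans c2 cw.
    rewrite lef_pV2 ?posrE; first by apply: ler_pM => //; exact: ltW.
      exact: (mulr_gt0 cv0 cw0).
    exact: (mulr_gt0 c2 c2).
have -> : gcoef a qv * v k - gcoef a qw * w k
  = gcoef a qv * (v k - w k) + (gcoef a qv - gcoef a qw) * w k by ring.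
apply: le_trans (ler_normD _ _) _.
rewrite (normrM (gcoef a qv)) (normrM (_ - _)) mulrDl; apply: lerD.
  by apply: ler_pM => //; exact: dk.
rewrite [leRHS](_ : _ = L2 * (n%:R * (2 * Num.sqrt b) * S) * Num.sqrt b).
  apply: ler_pM => //; apply: le_trans dg _.
  by apply: ler_wpM2l => //; exact: dq.
by ring.
Qed.

Lemma family_cont_at (R : realType) (I : finType) (f : I -> R -> R) (T eps : R) :
  (forall i, {for T, continuous (f i)}) -> 0 < eps ->
  exists2 del, 0 < del &
    forall i t, `|t - T| <= del -> `|f i t - f i T| <= eps.
Proof.
move=> fc eps0.
have : \forall t \near T, forall i, `|f i t - f i T| <= eps.
  apply: (@filter_forall _ _ (fun i t => `|f i t - f i T| <= eps) (nbhs T)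
    (nbhs_filter T)) => i.
  have /cvgrPdist_le /(_ _ eps0) := fc i.
  by apply: filterS => t; rewrite distrC.
move=> /nbhs_ballP[d /= d0 dP]; exists (d / 2); first by rewrite divr_gt0.
move=> i t tT; apply: dP; rewrite /ball/= distrC.
by apply: le_lt_trans tT _; rewrite ltr_pdivrMr// ltr_pMr// ltr1n.
Qed.

Lemma finite_pos_lb (R : realType) (I : finType) (f : I -> R) :
  (forall i, 0 < f i) -> exists2 c, 0 < c & forall i, c <= f i.
Proof.
move=> f0; have : \forall c \near (0 : R)^'+, forall i, c <= f i.
  by apply: (@filter_forall _ _ (fun i c => c <= f i)) => i; exact: nbhs_right_le.
move=> H; near (0 : R)^'+ => c; exists c; first by near: c; exact: nbhs_right_gt.
by near: c.
Unshelve. all: by end_near. Qed.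

Lemma le_left_closed (R : realType) (f : R -> R) (c T : R) :
  0 < T -> {for T, continuous f} -> (forall t, 0 <= t < T -> f t <= c) ->
  f T <= c.
Proof.
move=> T0 fc fle; rewrite leNgt; apply/negP => cf.
have /nbhs_ballP[d /= d0 dP] : \forall t \near T, c < f t.
  by apply: (cvgr_gt (f T) fc).
pose m := Num.min d T.
have m0 : 0 < m by rewrite /m lt_min d0.
have md : m <= d by rewrite /m ge_min lexx.
have mT : m <= T by rewrite /m ge_min lexx orbT.
have : c < f (T - m / 2).
  by apply: dP; rewrite /ball/= opprB addrC subrK gtr0_norm; lra.
by apply/negP; rewrite -leNgt; apply: fle; lra.
Qed.

Lemma window_dist (R : realType) (T s t d d1 : R) :
  T <= s <= t -> t <= T + d -> d <= d1 -> `|s - T| <= d1.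
Proof. by move=> /andP[Ts st] td dd; rewrite ger0_norm; lra. Qed.

(** The left side is the cost of one edge in the gain condition, for mismatch constants 0 and [L]
    and delay bound [del], with [m] for [n%:R * L]. The weight [b] keeps the first term within half
    of [c / M], and [del] is then small enough relative to [b] to do the same for the second. *)
Lemma local_gain_le (R : realType) (p L m c M b del : R) :
  0 < p -> 0 <= L -> 0 <= m -> 0 < c -> 0 < M ->
  b = c / (M * p * (L + 1)) -> 0 <= del <= 1 ->
  del <= b * c / (M * p * (m + 1)) ->
  b * p * (0 + L) / 2 + p * (0 + m) * del ^+ 2 / (2 * b) <= c / M.
Proof.
move=> p0 L0 m0 c0 M0 bE /andP[del0 del1] delw.
have nM : M != 0 by rewrite gt_eqF.
have np : p != 0 by rewrite gt_eqF.
have frac (z : R) : 0 <= z -> 0 <= z / (z + 1) <= 1.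
  move=> z0; have z1 : 0 < z + 1 by lra.
  by rewrite divr_ge0 ?(ltW z1)//= ler_pdivrMr//; lra.
have cM0 : 0 < c / M by exact: divr_gt0.
have b0 : 0 < b.
  rewrite bE; apply: divr_gt0 => //; apply: mulr_gt0; last by lra.
  exact: mulr_gt0.
have H1 : b * p * L <= c / M.
  have -> : b * p * L = c / M * (L / (L + 1)).
    by rewrite bE; field; rewrite nM np gt_eqF//; lra.
  by have /andP[_ f1] := frac L L0; rewrite ler_piMr// ltW.
have H2 : p * m * del ^+ 2 <= b * (c / M).
  apply: (@le_trans _ _ (p * m * (b * c / (M * p * (m + 1))))).
    apply: ler_wpM2l; first by apply: mulr_ge0 => //; exact: ltW.
    by apply: le_trans delw; rewrite expr2 ler_piMr.
  have -> : p * m * (b * c / (M * p * (m + 1))) = b * (c / M) * (m / (m + 1)).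
    by field; rewrite nM np gt_eqF//; lra.
  have /andP[_ f1] := frac m m0; rewrite ler_piMr//.
  by apply: mulr_ge0; exact: ltW.
rewrite !add0r.
have H3 : p * m * del ^+ 2 / (2 * b) <= c / M / 2.
  rewrite ler_pdivrMr; last by apply: mulr_gt0.
  by rewrite (_ : c / M / 2 * (2 * b) = b * (c / M)); last by field.
lra.
Qed.

Lemma cvg0_le (R : realType) (f h : R -> R) :
  (forall t, 0 < t -> `|f t| <= h t) -> h t @[t --> +oo] --> (0 : R) ->
  f t @[t --> +oo] --> (0 : R).
Proof.
move=> fh /cvgrPdist_le h0; apply/cvgrPdist_le => eps /h0[A [Areal AP]].
exists (Num.max A 0); split; first exact: num_real.
move=> t; rewrite gt_max => /andP[At t0]; rewrite sub0r normrN.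
apply: le_trans (fh t t0) _; apply: le_trans (ler_norm _) _.
by have := AP t At; rewrite sub0r normrN.
Qed.

Lemma cvg_translate (R : realType) (f : R -> R) (l c : R) :
  f t @[t --> +oo] --> l -> f (t - c) @[t --> +oo] --> l.
Proof.
move=> /cvgrPdist_le fl; apply/cvgrPdist_le => eps /fl[A [Areal AP]].
exists (A + c); split; first exact: num_real.
by move=> t; rewrite -ltrBrDr => /AP.
Qed.

Lemma cvg_sqrt0 (R : realType) (f : R -> R) :
  f t @[t --> +oo] --> (0 : R) -> Num.sqrt (f t) @[t --> +oo] --> (0 : R).
Proof.
move=> f0; rewrite -[X in _ --> X]sqrtr0.
by apply: continuous_cvg => //; exact: sqrt_continuous.
Qed.

Lemma lipschitz_of_derive (R : realType) (f df : R -> R) (M s t : R) :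
  0 < s <= t -> (forall v : R, 0 < v -> is_derive v 1 f (df v)) ->
  (forall v, 0 < v -> `|df v| <= M) -> `|f t - f s| <= M * (t - s).
Proof.
move=> /andP[s0 st] fd dfM.
have fd' v : s <= v <= t -> is_derive v 1 f (df v).
  by move=> /andP[sv _]; apply: fd; exact: lt_le_trans sv.
have dfM' v : s < v < t -> - M <= df v <= M.
  by move=> /andP[sv _]; rewrite -ler_norml; apply: dfM; exact: lt_trans sv.
have up : f t - M * t <= f s - M * s.
  rewrite -lerN2.
  apply: (@is_derive_ge0_le R (fun v => - (f v - M * v)) (fun v => - (df v - M))) => //.
    move=> v /fd' dv; exact: is_deriveN (is_derive_subf dv (is_derive_mulc M v)).
  by move=> v /dfM' /andP[_ h]; rewrite oppr_ge0 subr_le0.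
have dn : f s - (- M) * s <= f t - (- M) * t.
  apply: (@is_derive_ge0_le R (fun v => f v - (- M) * v) (fun v => df v - - M)) => //.
    by move=> v /fd' dv; exact: is_derive_subf dv (is_derive_mulc (- M) v).
  by move=> v /dfM' /andP[h _]; rewrite subr_ge0.
by rewrite ler_norml; apply/andP; split; lra.
Qed.

Lemma sqrt_sum_sqr_le (R : realType) (n : nat) (v : 'I_n -> R) (c : R) :
  0 <= c -> (forall k, `|v k| <= c) ->
  Num.sqrt (\sum_k v k ^+ 2) <= (n%:R + 1) * c.
Proof.
move=> c0 vc; have n0 : 0 <= n%:R :> R by exact: ler0n.
have nc0 : 0 <= (n%:R + 1) * c by apply: mulr_ge0 => //; lra.
rewrite -[leRHS]ger0_norm// -sqrtr_sqr ler_wsqrtr//.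
apply: (@le_trans _ _ (\sum_(k < n) c ^+ 2)).
  apply: ler_sum => k _; rewrite -[leLHS]real_normK ?num_real//.
  by rewrite ler_sqr ?nnegrE.
rewrite sumr_const card_ord -[leLHS]mulr_natl exprMn.
apply: ler_wpM2r; first exact: sqr_ge0.
have := mulr_ge0 n0 n0; lra.
Qed.

Lemma cvg_sum0 (R : realType) (I : Type) (s : seq I) (P : pred I)
    (f : I -> R -> R) :
  (forall i, P i -> f i t @[t --> +oo] --> (0 : R)) ->
  \sum_(i <- s | P i) f i t @[t --> +oo] --> (0 : R).
Proof.
move=> f0; have /(_ (fun=> 0)) := @cvg_sumf R R +oo I s P f.
by rewrite [X in _ --> X]big1//; apply.
Qed.

(** * Invariance of the energy sublevel set and of the edge bounds *)

Section System.
Context {R : realType} {N n : nat}.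
Variables (E : rel 'I_N) (r a p : R) (X U : 'I_N -> 'I_n -> R -> R).
Variables (Y : 'I_N -> 'I_N -> 'I_n -> R -> R) (kap : 'I_N -> 'I_n -> R).
Variables (kmin : 'I_N -> R) (al D : 'I_N -> 'I_N -> R) (g e : R).
Variables (F Phi : 'I_N -> R -> R).
Hypothesis Esym : symmetric E.
Hypothesis r_gt0 : 0 < r.
Hypothesis ra : r ^+ 2 < a.
Hypothesis p_gt0 : 0 < p.
Hypothesis dX : forall i k (t : R), is_derive t 1 (X i k) (U i k t).
Hypothesis cU : forall i k, continuous (U i k).
Hypothesis dU : forall i k (t : R), 0 < t -> is_derive t 1 (U i k)
  (- (p * \sum_(j | E i j) gcoef a (\sum_l (X i l t - Y i j l t) ^+ 2)
                           * (X i k t - Y i j k t)) - kap i k * U i k t).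
Hypothesis kminP : forall i k, kmin i <= kap i k.
Hypothesis al_gt0 : forall i j, E i j -> 0 < al i j.
Hypothesis D_ge0 : forall i j, E i j -> 0 <= D i j.
Hypothesis g_ge0 : 0 <= g.
Hypothesis e_ge0 : 0 <= e.
Hypothesis YP : forall i j (t : R), E i j -> 0 < t ->
  exists2 s : R, t - D i j <= s <= t & forall k, Y i j k t = X j k s.
Hypothesis dF : forall i (t : R), is_derive t 1 (F i) (\sum_k U i k t ^+ 2).
Hypothesis dPhi : forall i (t : R), is_derive t 1 (Phi i) (F i t).
Hypothesis F0 : forall i, F i 0 = 0.
Hypothesis F_ge0 : forall i (t : R), 0 <= F i t.

Let V := lyap E a p X U.
(** The excess of the damping gain over the gain condition. *)
Let margin i := kmin i - \sum_(j | E i j)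
  (al i j * p * (g + e) / 2
   + p * (g + n%:R * e) * D j i ^+ 2 / (2 * al j i)).

Hypothesis mm : forall i j k (t : R), E i j -> 0 < t -> V t <= V 0 ->
  `|gcoef a (dist2 X i j t) * (X i k t - X j k t)
    - gcoef a (\sum_l (X i l t - Y i j l t) ^+ 2) * (X i k t - Y i j k t)|
  <= g * `|X j k t - Y i j k t|
     + e * Num.sqrt (\sum_l (X j l t - Y i j l t) ^+ 2).
Hypothesis margin_gt0 : forall i, 0 < margin i.
Hypothesis q0 : forall i j, E i j -> dist2 X i j 0 < r ^+ 2.
Hypothesis V0 : V 0 < p * (r ^+ 2 / (a - r ^+ 2)).

Let dist2_ge0 i j t : 0 <= dist2 X i j t.
Proof. by apply: sumr_ge0 => k _; exact: sqr_ge0. Qed.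

Let kmin_gt0 i : 0 < kmin i.
Proof.
apply: lt_le_trans (margin_gt0 i) _; rewrite gerBl; apply: sumr_ge0 => j Eij.
have Eji : E j i by rewrite Esym.
have al1 := al_gt0 Eij; have al2 := al_gt0 Eji.
apply: addr_ge0.
  by apply: divr_ge0 => //; do 2?apply: mulr_ge0; rewrite ?addr_ge0// ltW.
apply: divr_ge0; last by apply: mulr_ge0 => //; exact: ltW.
apply: mulr_ge0 (sqr_ge0 _); apply: mulr_ge0; first exact: ltW.
by apply: addr_ge0 => //; apply: mulr_ge0.
Qed.

(** Edge lengths taken at two different instants near [T], as a delay produces them, also stay away
    from the pole: their squares remain below the midpoint of [r ^+ 2] and [a]. *)
Let near_close T : (forall i j, E i j -> dist2 X i j T < r ^+ 2) ->
  exists2 del, 0 < del & forall i j t s, E i j ->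
    `|t - T| <= del -> `|s - T| <= del ->
    \sum_k (X i k t - X j k s) ^+ 2 <= (r ^+ 2 + a) / 2.
Proof.
have [r0 ra'] := (r_gt0, ra).
(* Moving both endpoints by at most [eps <= 1 / 2] changes each squared coordinate by at most
   [2 * eps * (2 * r + 1)]; [m] makes the [n] changes add up to at most half of the gap
   [a - r ^+ 2]. *)
move=> qT; pose m : R := 4 * (n%:R + 1) * (2 * r + 1).
have n0 : 0 <= n%:R :> R by exact: ler0n.
have m0 : 0 < m by rewrite /m; apply: mulr_gt0; lra.
pose eps := Num.min (1 / 2) ((a - r ^+ 2) / m).
have eps0 : 0 < eps.
  by rewrite /eps lt_min divr_gt0//= divr_gt0// subr_gt0.
have eps1 : eps <= 1 / 2 by rewrite /eps ge_min lexx.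
have eps2 : eps * m <= a - r ^+ 2.
  by rewrite -ler_pdivlMr// /eps ge_min lexx orbT.
have [del del0 delP] := @family_cont_at R ('I_N * 'I_n)%type
  (fun ik => X ik.1 ik.2) T eps (fun ik => is_derive_continuous (dX _ _ _)) eps0.
exists del => // i j t s Eij tT sT.
apply: (@le_trans _ _ (\sum_k ((X i k T - X j k T) ^+ 2
                              + 2 * eps * (2 * r + 1)))).
  apply: ler_sum => k _.
  have h1 := delP (i, k) t tT; have h2 := delP (j, k) s sT.
  set z := X i k T - X j k T.
  pose h := (X i k t - X i k T) - (X j k s - X j k T).
  rewrite (_ : X i k t - X j k s = z + h); last by rewrite /z /h; ring.
  have zr : `|z| <= r.
    rewrite -[leRHS]gtr0_norm// -ler_sqr ?nnegrE// !real_normK ?num_real//.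
    apply: le_trans (ltW (qT i j Eij)).
    rewrite /dist2 (bigD1 k)//= lerDl; apply: sumr_ge0 => l _; exact: sqr_ge0.
  have hz : `|h| <= 2 * eps.
    by apply: le_trans (ler_normB _ _) _; move: h1 h2 => /=; lra.
  rewrite (_ : (z + h) ^+ 2 = z ^+ 2 + h * (2 * z + h)); last by ring.
  rewrite lerD2l; apply: le_trans (ler_norm _) _; rewrite normrM.
  apply: ler_pM => //; apply: le_trans (ler_normD _ _) _.
  by rewrite normrM gtr0_norm//; lra.
rewrite big_split/= sumr_const card_ord -[X in _ + X]mulr_natr.
have := qT i j Eij; rewrite /dist2 => qTij.
have : 2 * eps * (2 * r + 1) * n%:R <= (a - r ^+ 2) / 2.
  rewrite ler_pdivlMr//; apply: le_trans eps2.
  rewrite (_ : _ * 2 = eps * (4 * n%:R * (2 * r + 1))); last by ring.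
  apply: ler_wpM2l; first exact: ltW.
  by rewrite /m; apply: ler_wpM2r; lra.
lra.
Qed.

(* Constancy up to [T] makes the delay on [T, T + del] effectively at most
   [del], so a plain Lipschitz bound on the gradient replaces the mismatch
   property there. *)
Let local_descent T : 0 <= T ->
  (forall i j, E i j -> dist2 X i j T < r ^+ 2) -> (forall i, F i T = 0) ->
  exists2 del, 0 < del & forall t, T <= t <= T + del -> V t <= V T.
Proof.
have [[r0 ra'] p0] := (r_gt0, ra, p_gt0).
move=> T0 qT FT; have r2 := sqr_ge0 r.
have ba : 0 <= (r ^+ 2 + a) / 2 < a by apply/andP; split; lra.
have [L L0 LP] := gcoef_lipschitz n ba.
have [c c0 cP] := finite_pos_lb kmin_gt0.
have n0 : 0 <= n%:R :> R by exact: ler0n.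
have N0 : 0 <= N%:R :> R by exact: ler0n.
pose M : R := N%:R + 1; have M0 : 0 < M by rewrite /M; lra.
pose b := c / (M * p * (L + 1)).
have b0 : 0 < b.
  by apply: divr_gt0 => //; apply: mulr_gt0; [exact: mulr_gt0|lra].
pose w := b * c / (M * p * (n%:R * L + 1)).
have nL0 : 0 <= n%:R * L by exact: mulr_ge0.
have w0 : 0 < w.
  apply: divr_gt0; first exact: mulr_gt0.
  by apply: mulr_gt0; [exact: mulr_gt0|lra].
have [del1 del10 del1P] := near_close qT.
pose del := Num.min del1 (Num.min 1 w).
have del0 : 0 < del by rewrite /del !lt_min del10 ltr01.
have deld1 : del <= del1 by rewrite /del ge_min lexx.
have del_1 : del <= 1 by rewrite /del !ge_min lexx orbT.
have delw : del <= w by rewrite /del !ge_min lexx !orbT.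
exists del => // t /andP[Tt tdel].
have YP' i j s : E i j -> T < s < t ->
    exists2 s', T <= s' <= s & forall k, Y i j k s = X j k s'.
  move=> Eij /andP[Ts st].
  have [s' /andP[_ s's] s'P] := YP Eij (le_lt_trans T0 Ts).
  have [Ts'|s'T] := leP T s'; first by exists s' => //; rewrite Ts'.
  (* A delayed instant before [T] can be replaced by [T]: since [F j T = 0], the displacement bound
     shows that agent [j] has not moved in between. *)
  exists T; first by rewrite lexx ltW.
  move=> k; rewrite s'P; apply/eqP; rewrite eq_sym -subr_eq0 -sqrf_eq0 eq_le sqr_ge0.
  rewrite andbT; apply: (@le_trans _ _ (\sum_k (X j k T - X j k s') ^+ 2)).
    by rewrite (bigD1 k)//= lerDl; apply: sumr_ge0 => l _; exact: sqr_ge0.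
  apply: le_trans (displacement_sqr_le (dX j) (dF j) (ltW s'T)) _.
  by rewrite FT sub0r mulrN oppr_le0 mulr_ge0// subr_ge0 ltW.
(* The dissipation inequality is restarted at [T] with mismatch constants 0 and [L], a single Young
   weight [b] and delay bound [del]. *)
have := @dissipation R N n E a p X U Esym p_gt0 dX Y kap kmin
  (fun _ _ => b) (fun _ _ => del) 0 L F Phi T t Tt.
move=> /(_ _ cU _ kminP _ _ (lexx _) L0 _ _ dF dPhi F_ge0 FT) diss.
apply: le_trans (diss _ _ _ _ _ _) => //; last first.
- move=> i j s Eij sT; have [s' /andP[Ts' s's] s'P] := YP' i j s Eij sT.
  exists s' => //; rewrite s's andbT; move: sT => /andP[_ st].
  by apply: le_trans Ts'; rewrite lerBlDr; exact: le_trans (ltW st) tdel.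
- move=> i j k s Eij sT; have [s' /andP[Ts' s's] s'P] := YP' i j s Eij sT.
  move: sT => /andP[Ts st].
  have sd : `|s - T| <= del1.
    by apply: window_dist tdel deld1; rewrite (ltW Ts) (ltW st).
  have sd' : `|s' - T| <= del1.
    by apply: window_dist tdel deld1; rewrite Ts' (le_trans s's (ltW st)).
  rewrite mul0r add0r.
  have := LP (fun k => X i k s - X j k s) (fun k => X i k s - Y i j k s)
    (del1P i j s s Eij sd sd) _ k.
  rewrite (_ : \sum_l (X j l s - Y i j l s) ^+ 2
             = \sum_l (X i l s - X j l s - (X i l s - Y i j l s)) ^+ 2).
    apply; rewrite (eq_bigr (fun l => (X i l s - X j l s') ^+ 2)).
      exact: del1P.
    by move=> l _; rewrite s'P.
  by apply: eq_bigr => l _; ring.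
- by move=> i j _; exact: ltW.
- by move=> i k s /andP[Ts _]; apply: dU; exact: le_lt_trans Ts.
- move=> i j s Eij Tst.
  have sd : `|s - T| <= del1 by apply: window_dist tdel deld1.
  have /andP[_] := ba; apply: le_lt_trans.
  exact: (del1P i j s s Eij sd sd).
(* It remains to see that the new margins are nonnegative: each edge costs at most [c / M], and an
   agent has at most [N] neighbours. *)
rewrite lerDl; apply: sumr_ge0 => i _; apply: mulr_ge0 => //.
rewrite subr_ge0; apply: le_trans (cP i).
rewrite sumr_const; apply: (@le_trans _ _ (c / M *+ N)); last first.
  rewrite -mulr_natl mulrA ler_pdivrMr// mulrC ler_wpM2l ?(ltW c0)//.
  by rewrite /M lerDl.
apply: (@le_trans _ _ (c / M *+ #|E i|)); last first.
  apply: ler_wpMn2l; first exact: (divr_ge0 (ltW c0) (ltW M0)).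
  by rewrite -[leqRHS](card_ord N) max_card.
rewrite lerMn2r; apply/orP; right.
by apply: local_gain_le => //; rewrite (ltW del0).
Qed.

Let pot_ge0 i j t : E i j -> dist2 X i j t <= r ^+ 2 ->
  0 <= dist2 X i j t / (a - dist2 X i j t).
Proof.
move=> Eij q; apply: divr_ge0 => //; rewrite subr_ge0.
exact: le_trans q (ltW ra).
Qed.

Let V_ge0 t : (forall i j, E i j -> dist2 X i j t <= r ^+ 2) -> 0 <= V t.
Proof.
move=> q; apply: addr_ge0; apply: mulr_ge0.
- exact: divr_ge0 (ltW p_gt0) (ler0n _ _).
- by apply: sumr_ge0 => i _; apply: sumr_ge0 => j Eij; exact: pot_ge0 (q i j Eij).
- exact: divr_ge0.
- by apply: sumr_ge0 => i _; apply: sumr_ge0 => k _; exact: sqr_ge0.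
Qed.

(** An edge of length exactly [r] occurs in the energy once from each end. With the factor [p / 2]
    these two summands alone already reach the energy threshold. *)
Let sublevel t : (forall i j, E i j -> dist2 X i j t <= r ^+ 2) ->
  V t < p * (r ^+ 2 / (a - r ^+ 2)) ->
  forall i j, E i j -> dist2 X i j t < r ^+ 2.
Proof.
(* A loop has length 0; for distinct endpoints there really are two summands. *)
move=> q Vt i j Eij; have [ij|ij] := eqVneq i j.
  by rewrite ij /dist2 big1 ?exprn_gt0// => k _; rewrite subrr expr0n.
rewrite lt_neqAle q// andbT; apply/eqP => qE.
have Eji : E j i by rewrite Esym.
have qE' : dist2 X j i t = r ^+ 2.
  by rewrite -qE; apply: eq_bigr => k _; rewrite -[in LHS]opprB sqrrN.
pose S i' := \sum_(j' | E i' j') dist2 X i' j' t / (a - dist2 X i' j' t).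
have S_ge i' j' : E i' j' -> dist2 X i' j' t / (a - dist2 X i' j' t) <= S i'.
  move=> Eij'; rewrite /S (bigD1 j')//= lerDl; apply: sumr_ge0 => l /andP[Eil _].
  exact: pot_ge0 (q _ _ Eil).
have S0 i' : 0 <= S i'.
  by apply: sumr_ge0 => l Eil; exact: pot_ge0 (q _ _ Eil).
move: Vt; apply/negP; rewrite -leNgt.
have h1 := S_ge i j Eij; have h2 := S_ge j i Eji.
rewrite qE in h1; rewrite qE' in h2.
have h3 : S i + S j <= \sum_i' S i'.
  rewrite (bigD1 i)//= lerD2l (bigD1 j)/=; last by rewrite eq_sym.
  by rewrite lerDl; apply: sumr_ge0.
have h4 : p * (r ^+ 2 / (a - r ^+ 2)) <= p / 2 * \sum_i' S i'.
  rewrite -mulrA ler_pM2l// [leRHS]mulrC ler_pdivlMr//.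
  apply: le_trans h3; rewrite mulr_natr mulr2n; exact: lerD.
apply: le_trans h4 _; rewrite /V /lyap lerDl; apply: mulr_ge0.
  exact: divr_ge0.
by apply: sumr_ge0 => i' _; apply: sumr_ge0 => k _; exact: sqr_ge0.
Qed.

Let cV t : (forall i j, E i j -> dist2 X i j t <= r ^+ 2) ->
  {for t, continuous V}.
Proof.
move=> q; apply: (continuous_lyap dX) => [i j Eij|i k].
  exact: le_lt_trans (q i j Eij) ra.
exact: cU.
Qed.

Let global_dissipation T : 0 <= T ->
  (forall t, 0 <= t <= T ->
    V t <= V 0 /\ forall i j, E i j -> dist2 X i j t < r ^+ 2) ->
  V T + \sum_i margin i * F i T <= V 0.
Proof.
move=> T0 PT; apply: (@dissipation R N n E a p X U Esym p_gt0 dX Y kap kmin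
  al D g e F Phi 0 T T0) => //.
- by move=> i j t Eij /PT[_ /(_ i j Eij) q]; exact: lt_trans ra.
- by move=> i k t /andP[t0 _]; exact: dU.
- move=> i j k t Eij /andP[t0 tT]; apply: mm => //.
  by apply: (PT t _).1; rewrite (ltW t0) (ltW tT).
- by move=> i j t Eij /andP[t0 _]; exact: YP.
Qed.

Lemma lyap_invariance t : 0 <= t ->
  V t <= V 0 /\ forall i j, E i j -> dist2 X i j t < r ^+ 2.
Proof.
move: t; apply: real_induction => //.
  move=> T T0 PT.
  (* Passing to the limit leaves only the non-strict edge bound; the energy bound makes it strict
     again. *)
  have qT i j : E i j -> dist2 X i j T <= r ^+ 2.
    move=> Eij; apply: (le_left_closed T0).
      exact: is_derive_continuous (is_derive_dist2 dX i j T).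
    by move=> t /PT[_ /(_ i j Eij) /ltW].
  have VT : V T <= V 0.
    by apply: (le_left_closed T0 (cV qT)) => t /PT[].
  by split=> //; apply: sublevel qT _; exact: le_lt_trans V0.
move=> T T0 PT.
have [VT qT] := PT T ltac:(by rewrite T0 lexx).
have diss := global_dissipation T0 PT.
have [d1 d10 d1P] : exists2 d, 0 < d & forall t, T <= t <= T + d ->
    forall i j, E i j -> dist2 X i j t < r ^+ 2.
  have : \forall t \near T, forall ij : 'I_N * 'I_N,
      E ij.1 ij.2 -> dist2 X ij.1 ij.2 t < r ^+ 2.
    apply: (@filter_forall _ _ (fun (ij : 'I_N * 'I_N) t =>
      E ij.1 ij.2 -> dist2 X ij.1 ij.2 t < r ^+ 2) (nbhs T) (nbhs_filter T)).
    move=> [i j] /=; have [Eij|nE] := boolP (E i j); last exact: nearW.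
    have := is_derive_continuous (is_derive_dist2 dX i j T).
    by move=> /cvgr_lt/(_ _ (qT i j Eij)); apply: filterS.
  move=> /nbhs_ballP[d /= d0 dP]; exists (d / 2); first by rewrite divr_gt0.
  move=> t /andP[Tt td] i j; apply: (dP t _ (i, j)).
  by rewrite /ball/= ler0_norm ?subr_le0//; lra.
have [d2 d20 d2P] : exists2 d, 0 < d & forall t, T <= t <= T + d -> V t <= V 0.
  (* If some agent has moved, its margin term gives [V T < V 0] and continuity suffices; otherwise
     all agents have been at rest and the local descent applies. *)
  have [FT|/existsNP[i FiT]] := pselect (forall i, F i T = 0).
    have [d d0 dP] := local_descent T0 qT FT.
    by exists d => // t /dP tT; exact: le_trans VT.
  have VT' : V T < V 0.
    apply: lt_le_trans diss; rewrite ltrDl (bigD1 i)//=.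
    have Fi : 0 < F i T by rewrite lt_neqAle F_ge0 andbT eq_sym; apply/eqP.
    apply: ltr_pwDl; first exact: mulr_gt0.
    by apply: sumr_ge0 => l _; apply: mulr_ge0 => //; exact: ltW.
  have : \forall t \near T, V t < V 0.
    by apply: (cvgr_lt (V T) (cV _)) => // i' j' /qT /ltW.
  move=> /nbhs_ballP[d /= d0 dP]; exists (d / 2); first by rewrite divr_gt0.
  move=> t /andP[Tt td]; apply/ltW/dP.
  by rewrite /ball/= ler0_norm ?subr_le0//; lra.
exists (Num.min d1 d2); first by rewrite lt_min d10.
move=> t /andP[Tt]; rewrite -lerBlDl le_min => /andP[t1 t2].
by split; [apply: d2P|apply: d1P]; rewrite Tt/= -lerBlDl.
Qed.

Lemma lyap_decay t : 0 <= t -> V t + \sum_i margin i * F i t <= V 0.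
Proof.
move=> t0; apply: global_dissipation => // s /andP[s0 _].
exact: lyap_invariance.
Qed.

Lemma lyap_ge0 t : 0 <= t -> 0 <= V t.
Proof. by move=> /lyap_invariance[_ q]; apply: V_ge0 => i j /q /ltW. Qed.

(** * Convergence of velocities, gradients and edge lengths *)

Let G i j k t := gcoef a (dist2 X i j t) * (X i k t - X j k t).
Let W i j t := \sum_l (X j l t - Y i j l t) ^+ 2.
Let Gd i j k t := gcoef a (\sum_l (X i l t - Y i j l t) ^+ 2)
                  * (X i k t - Y i j k t).

Let F_bound i t : F i t <= V 0 / margin i.
Proof.
have V00 := lyap_ge0 (lexx 0).
have [t0|/ltW t0] := leP 0 t; last first.
  apply: le_trans (energy_primitive_nd (dF i) t0) _.
  by rewrite F0 divr_ge0// ltW.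
rewrite ler_pdivlMr// mulrC; apply: le_trans (lyap_decay t0).
rewrite (bigD1 i)//= addrCA lerDl; apply: addr_ge0; first exact: lyap_ge0.
by apply: sumr_ge0 => l _; apply: mulr_ge0 => //; exact: ltW.
Qed.

Let F_cvg i : exists l : R, F i t @[t --> +oo] --> l.
Proof.
exists (sup (range (F i))); apply: nondecreasing_cvgr.
  by move=> s t st; exact: energy_primitive_nd st.
by exists (V 0 / margin i) => _ [t _ <-]; exact: F_bound.
Qed.

(** The kinetic part of the energy is half the sum of the squared velocity components, so [V 0]
    bounds each component. *)
Let speed := Num.sqrt (2 * V 0).

Let U_bound i k t : 0 <= t -> `|U i k t| <= speed.
Proof.
move=> t0; rewrite -sqrtr_sqr ler_wsqrtr//.
have [Vt q] := lyap_invariance t0.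
rewrite mulrC -ler_pdivrMr//; apply: le_trans Vt.
have U2 : U i k t ^+ 2 <= \sum_i \sum_k U i k t ^+ 2.
  rewrite (bigD1 i)//= (bigD1 k)//= -addrA lerDl addr_ge0//.
    by apply: sumr_ge0 => l _; exact: sqr_ge0.
  by apply: sumr_ge0 => l _; apply: sumr_ge0 => l' _; exact: sqr_ge0.
apply: le_trans (_ : 1 / 2 * (\sum_i \sum_k U i k t ^+ 2) <= _).
  by rewrite mul1r mulrC ler_wpM2l// invr_ge0.
rewrite /V /lyap lerDr; apply: mulr_ge0; first exact: divr_ge0 (ltW p_gt0) (ler0n _ _).
apply: sumr_ge0 => i' _; apply: sumr_ge0 => j' Eij.
by apply: pot_ge0 (Eij) _; exact: ltW (q _ _ Eij).
Qed.

Let W_le i j t : E i j -> 0 < t -> W i j t <= D i j * (F j t - F j (t - D i j)).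
Proof.
move=> Eij t0; have [s ts Ys] := YP Eij t0.
have := delayed_displacement_le (dX j) (dF j) ts.
by rewrite /W; under [in X in _ -> X]eq_bigr do rewrite Ys.
Qed.

(** As [F j] converges, its increment over a window of fixed length vanishes, and with it the
    displacement during the delay. *)
Let sqrtW_cvg0 i j : E i j -> Num.sqrt (W i j t) @[t --> +oo] --> (0 : R).
Proof.
move=> Eij; have [l Fl] := F_cvg j.
apply: (@cvg0_le _ _ (fun t => Num.sqrt (D i j * (F j t - F j (t - D i j))))).
  by move=> t t0; rewrite ger0_norm ?sqrtr_ge0// ler_wsqrtr// W_le.
apply: cvg_sqrt0; rewrite -[X in _ --> X](mulr0 (D i j)) -[X in _ * X](subrr l).
by apply: cvg_mulcf; apply: cvgB => //; exact: cvg_translate.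
Qed.

Let mismatch_le i j k t : E i j -> 0 < t ->
  `|G i j k t - Gd i j k t| <= (g + e) * Num.sqrt (W i j t).
Proof.
move=> Eij t0; have [Vt _] := lyap_invariance (ltW t0).
apply: le_trans (mm _ Eij t0 Vt) _; rewrite mulrDl lerD2r ler_wpM2l//.
exact: (coord_le_sqrt (fun l => X j l t - Y i j l t)).
Qed.

(** By invariance the edges stay shorter than [r], away from the pole. The bound on [G] itself is
    the Lipschitz estimate against the zero vector. *)
Let G_lipschitz : exists2 L : R, 0 <= L & forall i j k t s, E i j ->
  0 <= t -> 0 <= s -> `|G i j k t| <= L * r /\
  `|G i j k t - G i j k s| <= L * Num.sqrt (\sum_l
      ((X i l t - X j l t) - (X i l s - X j l s)) ^+ 2).
Proof.
have ba : 0 <= r ^+ 2 < a by rewrite sqr_ge0.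
have [L L0 LP] := gcoef_lipschitz n ba; exists L => // i j k t s Eij t0 s0.
have [_ /(_ i j Eij) /ltW qt] := lyap_invariance t0.
have [_ /(_ i j Eij) /ltW qs] := lyap_invariance s0.
split; last exact: LP (fun l => X i l t - X j l t) (fun l => X i l s - X j l s) _ _ k.
have := LP (fun l => X i l t - X j l t) (fun _ => 0) qt _ k.
rewrite mulr0 subr0 => h; apply: le_trans (h _) _.
  by rewrite big1 ?sqr_ge0// => l _; rewrite expr0n.
apply: ler_wpM2l => //; rewrite -[leRHS]gtr0_norm// -sqrtr_sqr ler_wsqrtr//.
by under eq_bigr do rewrite subr0.
Qed.

Let dUval i k t := - (p * \sum_(j | E i j) Gd i j k t) - kap i k * U i k t.

(** Bounded accelerations make the squared speeds Lipschitz, as Barbalat's lemma requires. The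
    delayed gradient is bounded through the undelayed one plus the mismatch. *)
Let dU_bound i k : exists M : R, forall t, 0 < t -> `|dUval i k t| <= M.
Proof.
have [L L0 LP] := G_lipschitz.
exists (p * (\sum_(j | E i j) (L * r + (g + e) * Num.sqrt (D i j * (V 0 / margin j))))
        + `|kap i k| * speed) => t t0.
apply: le_trans (ler_normB _ _) _; apply: lerD; last first.
  by rewrite normrM ler_wpM2l// U_bound// ltW.
rewrite normrN normrM gtr0_norm// ler_pM2l//.
apply: le_trans (ler_norm_sum _ _ _) _; apply: ler_sum => j Eij.
rewrite -[Gd _ _ _ _](subKr (G i j k t)); apply: le_trans (ler_normB _ _) _.
apply: lerD; first by case: (LP i j k t t Eij (ltW t0) (ltW t0)).
apply: le_trans (mismatch_le k Eij t0) _; apply: ler_wpM2l; first exact: addr_ge0.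
apply: ler_wsqrtr; apply: le_trans (W_le Eij t0) _.
apply: ler_wpM2l; first exact: D_ge0.
by apply: le_trans (F_bound j t); rewrite gerBl.
Qed.

Let U_cvg0 i k : U i k t @[t --> +oo] --> (0 : R).
Proof.
have [l Fl] := F_cvg i.
have /(@choice _ _ (fun k M => forall t, 0 < t -> `|dUval i k t| <= M)) [M MP]
  : forall k, exists M : R, forall t, 0 < t -> `|dUval i k t| <= M.
  by move=> k'; exact: dU_bound.
(* Barbalat's lemma for [F i]; the Lipschitz constant comes from factoring each difference of
   squares, with [M k] bounding the acceleration and [2 * speed] the sum of the two velocities. *)
have K0 : \sum_k U i k t ^+ 2 @[t --> +oo] --> (0 : R).
  apply: (@barbalat R (F i) _ (fun=> 0) l (\sum_k M k * (2 * speed))) => //.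
  - exact: cvg_cst.
  - by move=> t _; rewrite addr0.
  move=> s t /[dup] st /andP[s0 st'].
  rewrite -sumrB mulr_suml; apply: le_trans (ler_norm_sum _ _ _) _.
  apply: ler_sum => k' _; rewrite subr_sqr normrM mulrAC; apply: ler_pM => //.
    exact: lipschitz_of_derive st (fun v => @dU i k' v) (MP k').
  apply: le_trans (ler_normD _ _) _; rewrite mulr_natl mulr2n.
  by apply: lerD; apply: U_bound; rewrite ltW// (lt_le_trans s0).
apply: (@cvg0_le _ _ (fun t => Num.sqrt (\sum_k U i k t ^+ 2))).
  by move=> t _; exact: (coord_le_sqrt (fun k => U i k t)).
exact: cvg_sqrt0.
Qed.

(** Barbalat's lemma for [U i k], which tends to 0. Its derivative is [- p] times the undelayed
    gradient sum plus an error made of the mismatch and the damping, both vanishing. *)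
Let gradient_cvg0 i k : \sum_(j | E i j) G i j k t @[t --> +oo] --> (0 : R).
Proof.
have [L L0 LP] := G_lipschitz.
have err0 : p * (\sum_(j | E i j) (G i j k t - Gd i j k t))
    - kap i k * U i k t @[t --> +oo] --> (0 : R).
  rewrite -[X in _ --> X](subr0 0); apply: cvgB; last first.
    by rewrite -[X in _ --> X](mulr0 (kap i k)); apply: cvg_mulcf; exact: U_cvg0.
  rewrite -[X in _ --> X](mulr0 p); apply: cvg_mulcf.
  apply: (@cvg0_le _ _ (fun t => \sum_(j | E i j) (g + e) * Num.sqrt (W i j t))).
    move=> t t0; apply: le_trans (ler_norm_sum _ _ _) _; apply: ler_sum => j Eij.
    exact: mismatch_le.
  apply: cvg_sum0 => j Eij; rewrite -[X in _ --> X](mulr0 (g + e)).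
  by apply: cvg_mulcf; exact: sqrtW_cvg0.
have := @barbalat R (U i k) (fun t => - (p * \sum_(j | E i j) G i j k t)) _ 0
  (p * \sum_(j | E i j) L * ((n%:R + 1) * (2 * speed))) (U_cvg0 i k) err0.
have -> : (fun t => \sum_(j | E i j) G i j k t)
   = (fun t => (- p^-1) * - (p * \sum_(j | E i j) G i j k t)).
  by apply/funext => t; rewrite mulrNN mulKf// gt_eqF.
move=> h; rewrite -[X in _ --> X](mulr0 (- p^-1)); apply: cvg_mulcf; apply: h.
  move=> t t0; apply: is_derive_eq (dU i k t0) _.
  by rewrite sumrB; ring.
move=> s t /andP[s0 st].
have t0 := lt_le_trans s0 st.
have sp0 : 0 <= speed by exact: sqrtr_ge0.
have ts0 : 0 <= t - s by rewrite subr_ge0.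
rewrite -opprD normrN -mulrBr normrM gtr0_norm// -mulrA ler_pM2l//.
rewrite -sumrB mulr_suml; apply: le_trans (ler_norm_sum _ _ _) _.
apply: ler_sum => j Eij.
have [_ h1] := LP i j k t s Eij (ltW t0) (ltW s0).
apply: le_trans h1 _; rewrite -mulrA; apply: ler_wpM2l => //; rewrite -mulrA.
apply: sqrt_sum_sqr_le => [|l]; first by rewrite !mulr_ge0.
have lipX i' : `|X i' l t - X i' l s| <= speed * (t - s).
  apply: (@lipschitz_of_derive R _ (U i' l) _ _ _ _ (fun v _ => dX i' l v)).
    by rewrite s0.
  by move=> v /ltW; exact: U_bound.
rewrite (_ : _ - _ - _ = (X i l t - X i l s) - (X j l t - X j l s)); last by ring.
apply: le_trans (ler_normB _ _) _.
by rewrite -mulrA mulr_natl mulr2n; exact: lerD.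
Qed.

(** Every edge of a path from [i] to [o] contributes at most [r]. *)
Let offset_bounded i o k : connect E i o ->
  exists B : R, forall t, 0 < t -> `|X i k t - X o k t| <= B.
Proof.
move: i o; apply: connect_ind_step.
  by move=> i; exists 0 => t _; rewrite subrr normr0.
move=> i j o Eij [B BP]; exists (r + B) => t t0.
rewrite (_ : _ - _ = (X i k t - X j k t) + (X j k t - X o k t)); last by ring.
apply: le_trans (ler_normD _ _) _; apply: lerD (BP t t0).
apply: le_trans (coord_le_sqrt (fun k => X i k t - X j k t) k) _.
rewrite -[leRHS]gtr0_norm// -sqrtr_sqr ler_wsqrtr//.
by have [_ /(_ i j Eij) /ltW] := lyap_invariance (ltW t0).
Qed.

Hypothesis Econn : forall i j, connect E i j.

(* Pairing the vanishing gradients with positions relative to a reference agent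
   [o] recovers the weighted sum of the squared edge lengths. *)
Let edge_cvg0 i j : E i j -> dist2 X i j t @[t --> +oo] --> (0 : R).
Proof.
move=> Eij; pose o := i.
have a0 : 0 < a by apply: le_lt_trans ra; exact: sqr_ge0.
have pair0 : a * (\sum_i \sum_k (X i k t - X o k t) * \sum_(j | E i j) G i j k t)
    @[t --> +oo] --> (0 : R).
  rewrite -[X in _ --> X](mulr0 a); apply: cvg_mulcf.
  apply: cvg_sum0 => i' _; apply: cvg_sum0 => k _; have [B BP] := offset_bounded k (Econn i' o).
  apply: (@cvg0_le _ _ (fun t => B * `|\sum_(j | E i' j) G i' j k t|)).
    by move=> t t0; rewrite normrM ler_wpM2r// BP.
  rewrite -[X in _ --> X](mulr0 B); apply: cvg_mulcf.
  by rewrite -[X in _ --> X](normr0 R); apply: cvg_norm; exact: gradient_cvg0.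
apply: cvg0_le pair0 => t t0; rewrite ger0_norm//.
have [_ q] := lyap_invariance (ltW t0).
have coup := @sum_coupling R N n E a X (fun i k t => X i k t - X o k t) Esym t.
(* The symmetrization identity with offsets from [o] in place of velocities: differences of offsets
   are again the edge vectors. *)
have -> : \sum_i \sum_k (X i k t - X o k t) * (\sum_(j | E i j) G i j k t)
  = 1 / 2 * \sum_i \sum_(j | E i j) gcoef a (dist2 X i j t) * dist2 X i j t.
  rewrite [in RHS](eq_bigr (fun i => \sum_(j | E i j) gcoef a (dist2 X i j t)
     * (\sum_k (X i k t - X j k t)
               * ((X i k t - X o k t) - (X j k t - X o k t))))); last first.
    move=> i' _; apply: eq_bigr => j' _; congr (_ * _); apply: eq_bigr => k _.
    by ring.
  rewrite coup mulrA mul1r mulVf// mul1r; apply: eq_bigr => i' _.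
  rewrite exchange_big/=; apply: eq_bigr => k _; rewrite mulr_sumr.
  by apply: eq_bigr => j' _; rewrite mulrC.
rewrite mulrA mul1r.
(* The factor [a] makes every weight at least 1, since [a / 2] times the coefficient is the square
   of [a / (a - q')]. *)
have term i' j' : E i' j' -> dist2 X i' j' t
    <= a / 2 * (gcoef a (dist2 X i' j' t) * dist2 X i' j' t).
  move=> Eij'; set q' := dist2 X i' j' t; have q'0 : 0 <= q' by exact: dist2_ge0.
  have aq : 0 < a - q' by rewrite subr_gt0; exact: lt_trans (q _ _ Eij') ra.
  rewrite mulrA ler_peMl// /gcoef.
  have -> : a / 2 * (2 * a / (a - q') ^+ 2) = (a / (a - q')) ^+ 2.
    by field; rewrite gt_eqF.
  by apply: exprn_ege1; rewrite ler_pdivlMr// mul1r gerBl.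
rewrite mulr_sumr (bigD1 i)//= mulr_sumr (bigD1 j)//= -addrA.
apply: le_trans (term i j Eij) _; rewrite lerDl; apply: addr_ge0.
  apply: sumr_ge0 => l /andP[Eil _]; apply: le_trans (term i l Eil); exact: dist2_ge0.
apply: sumr_ge0 => l _; rewrite mulr_sumr; apply: sumr_ge0 => l' Ell.
apply: le_trans (term l l' Ell); exact: dist2_ge0.
Qed.

Lemma consensus i j k : X i k t - X j k t @[t --> +oo] --> (0 : R).
Proof.
move: (Econn i j); apply: (@connect_ind_step _ E
  (fun i j => X i k t - X j k t @[t --> +oo] --> (0 : R))).
  move=> {}i; rewrite (_ : (fun _ => _) = fun=> 0); first exact: cvg_cst.
  by apply/funext => t; rewrite subrr.
move=> {}i {}j o Eij jo.
rewrite (_ : (fun _ => _) =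
   fun t => (X i k t - X j k t) + (X j k t - X o k t)); last first.
  by apply/funext => t; ring.
rewrite -[X in _ --> X](addr0 0); apply: cvgD jo.
apply: (@cvg0_le _ _ (fun t => Num.sqrt (dist2 X i j t))).
  by move=> t _; exact: (coord_le_sqrt (fun k => X i k t - X j k t)).
exact: cvg_sqrt0 (edge_cvg0 Eij).
Qed.

End System.

(** * From vectors to coordinates *)

Lemma euclid_sqr (R : realType) (n : nat) (v : 'cV[R]_n) :
  euclid v ^+ 2 = \sum_k v k 0 ^+ 2.
Proof. by rewrite sqr_sqrtr//; apply: sumr_ge0 => k _; exact: sqr_ge0. Qed.

Lemma psi_euclid (R : realType) (n : nat) (r Q : R) (v : 'cV[R]_n) :
  psi r Q (euclid v)
  = (\sum_k v k 0 ^+ 2) / (r ^+ 2 + Q - \sum_k v k 0 ^+ 2).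
Proof. by rewrite /psi euclid_sqr addrAC. Qed.

Lemma grad_psi_coord (R : realType) (n : nat) (r Q : R) (v : 'cV[R]_n) k :
  grad_psi r Q v k 0 = gcoef (r ^+ 2 + Q) (\sum_l v l 0 ^+ 2) * v k 0.
Proof. by rewrite /grad_psi mxE euclid_sqr /gcoef addrAC. Qed.

(** Passes from the infinity norm in the [eta] term of the mismatch property to the Euclidean norm
    used in the scalar system. *)
Lemma mx_norm_le_euclid (R : realType) (n : nat) (v : 'cV[R]_n) :
  `|v| <= euclid v.
Proof.
rewrite /Num.Def.normr/= mx_normrE bigmax_le ?sqrtr_ge0// => -[k l] _ /=.
by rewrite ord1; exact: (coord_le_sqrt (fun k => v k 0)).
Qed.

Lemma cvg_mx_coord (R : realType) (m n : nat) (f : R -> 'M[R]_(m, n)) :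
  (forall i j, f t i j @[t --> +oo] --> (0 : R)) ->
  f t @[t --> +oo] --> (0 : 'M[R]_(m, n)).
Proof.
move=> f0; apply/cvgrPdist_le => eps eps0.
have : \forall t \near +oo, forall ij : 'I_m * 'I_n, `|f t ij.1 ij.2| <= eps.
  apply: (@filter_forall _ _ (fun (ij : 'I_m * 'I_n) t =>
    `|f t ij.1 ij.2| <= eps) +oo) => -[i j] /=.
  have /cvgrPdist_le /(_ _ eps0) := f0 i j.
  by apply: filterS => t; rewrite sub0r normrN.
apply: filterS => t ft.
rewrite sub0r normrN /Num.Def.normr/= mx_normrE.
by apply: bigmax_le => [|ij _]; [exact: ltW|exact: ft].
Qed.

Lemma is_derive_coord (R : realType) (m n : nat) (f : R -> 'M[R]_(m, n))
    (t : R) (df : 'M[R]_(m, n)) i j :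
  is_derive t 1 f df -> is_derive t 1 (fun s => f s i j) (df i j).
Proof.
move=> [fd fE]; have /derivable_mxP fd' := fd.
apply: DeriveDef; first exact: fd'.
by rewrite -fE derive_mx// mxE.
Qed.

Lemma eigenvalue_diag (R : realType) (n : nat) (A : 'M[R]_n) (k : 'I_n) :
  is_diag_mx A -> eigenvalue A (A k k).
Proof.
move=> /is_diag_mxP Ad; apply/eigenvalueP; exists (delta_mx 0 k).
  apply/rowP => l; rewrite -rowE !mxE eqxx/=.
  have [->|lk] := eqVneq l k; first by rewrite mulr1.
  by rewrite mulr0 Ad// eq_sym.
apply/eqP => /matrixP/(_ 0 k); rewrite !mxE !eqxx/=.
by move/eqP; rewrite oner_eq0.
Qed.

Lemma diag_mulmx_coord (R : realType) (n : nat) (A : 'M[R]_n) (v : 'cV[R]_n) k :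
  is_diag_mx A -> (A *m v) k 0 = A k k * v k 0.
Proof.
move=> /is_diag_mxP Ad; rewrite mxE (bigD1 k)//= big1 ?addr0// => l lk.
by rewrite Ad ?mul0r// eq_sym.
Qed.

(** Freezing the argument at 0 is a 1-Lipschitz map into the half-line, so it extends the function
    continuously to the whole line. *)
Lemma continuous_max0 (R : realType) (h : R -> R) :
  {within `[0, +oo[, continuous h} ->
  continuous (fun t : R => h (Num.max t 0)).
Proof.
move=> /subspace_continuousP hc t.
have t0 : `[0, +oo[%classic (Num.max t 0) by rewrite /= in_itv/= le_max lexx orbT.
have /cvgrPdist_le hct := hc _ t0; apply/cvgrPdist_le => eps /hct.
rewrite /within/= => /nbhs_ballP[d /= d0 dP]; apply/nbhs_ballP; exists d => //= s.
rewrite /ball/= => ts; apply: dP; last by rewrite /= in_itv/= le_max lexx orbT.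
rewrite /ball/=; apply: le_lt_trans ts.
have [t_0|t_0] := leP t 0; have [s_0|s_0] := leP s 0.
- by rewrite subrr normr0.
- by rewrite sub0r normrN gtr0_norm// ler0_norm; lra.
- by rewrite subr0 gtr0_norm// gtr0_norm; lra.
- by [].
Qed.

(** The dynamics give derivatives only for [t > 0]. A primitive of [w] that vanishes up to 0 differs
    from [f] by the constant [f 0], so [f] is differentiable at 0 and before it as well. *)
Lemma is_derive_from_rest (R : realType) (f w : R -> R) :
  continuous f -> continuous w -> (forall t, t <= 0 -> f t = f 0) ->
  (forall t, t <= 0 -> w t = 0) ->
  (forall t : R, 0 < t -> is_derive t 1 f (w t)) ->
  forall t : R, is_derive t 1 f (w t).
Proof.
move=> fc wc f0 w0 fd.
have [P [dP P0]] := primitive_vanishing wc w0.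
suff fE : f = (fun t => P t + f 0).
  move=> t; rewrite fE.
  apply: is_derive_eq (is_derive_addf (dP t) (is_derive_cst (f 0) t 1)) _.
  exact: addr0.
apply/funext => t; have [t0|t0] := leP t 0; first by rewrite P0// f0// add0r.
have cP s : {for s, continuous P} by exact: is_derive_continuous (dP s).
have up : f 0 - P 0 <= f t - P t.
  apply: (@derive_ge0_le R (fun s => f s - P s) (fun s => w s - w s)) => //.
  - exact: ltW.
  - by move=> s /andP[s0 _]; exact: is_derive_subf (fd s s0) (dP s).
  - by move=> s _; rewrite subrr.
  - by move=> s _; apply: cvgB; [exact: fc|exact: cP].
have dn : P 0 - f 0 <= P t - f t.
  apply: (@derive_ge0_le R (fun s => P s - f s) (fun s => w s - w s)) => //.
  - exact: ltW.
  - by move=> s /andP[s0 _]; exact: is_derive_subf (dP s) (fd s s0).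
  - by move=> s _; rewrite subrr.
  - by move=> s _; apply: cvgB; [exact: cP|exact: fc].
have P00 := P0 0 (lexx 0); apply/eqP; rewrite eq_le; apply/andP; split; lra.
Qed.

(** The potential increases with the squared length below the pole, and a graph without loops has at
    most [N * (N - 1)] directed edges. *)
Lemma initial_potential (R : realType) (N : nat) (E : rel 'I_N) (r Q s : R)
    (q : 'I_N -> 'I_N -> R) : irreflexive E -> 0 < Q -> 0 <= s < r ->
  (forall i j, E i j -> 0 <= q i j <= s ^+ 2) ->
  \sum_i \sum_(j | E i j) q i j / (r ^+ 2 + Q - q i j)
  <= (N * (N - 1))%:R * psi r Q s.
Proof.
move=> Eirr Q0 /andP[s0 sr] qs.
have sr2 : s ^+ 2 < r ^+ 2 by rewrite ltr_sqr ?nnegrE//; lra.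
have psi0 : 0 <= psi r Q s by apply: divr_ge0; [exact: sqr_ge0|lra].
apply: (@le_trans _ _ (\sum_(i < N) \sum_(j | j != i) psi r Q s)).
  apply: ler_sum => i _; rewrite big_mkcond [leRHS]big_mkcond/=.
  apply: ler_sum => j _; have [Eij|nE] := boolP (E i j); last by case: ifP.
  have -> : j != i by apply: contraTneq Eij => ->; rewrite Eirr.
  have /andP[q0 q1] := qs i j Eij.
  rewrite /psi; apply: ler_pM => //; first by rewrite invr_ge0; lra.
  by rewrite lef_pV2 ?posrE; lra.
rewrite (eq_bigr (fun=> psi r Q s *+ (N - 1))); last first.
  move=> i _; rewrite sumr_const; congr (_ *+ _).
  by have := cardC1 i; rewrite card_ord subn1.
by rewrite sumr_const card_ord -mulrnA mulnC mulr_natl.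
Qed.

Lemma kinetic_primitives (R : realType) (I : Type) (n : nat)
    (U : I -> 'I_n -> R -> R) :
  (forall i k, continuous (U i k)) -> (forall i k t, t <= 0 -> U i k t = 0) ->
  exists F Phi : I -> R -> R,
    [/\ forall i (t : R), is_derive t 1 (F i) (\sum_k U i k t ^+ 2),
        forall i t, t <= 0 -> F i t = 0 &
        forall i (t : R), is_derive t 1 (Phi i) (F i t)].
Proof.
move=> cU U0.
have ex i : exists fp : (R -> R) * (R -> R),
    [/\ forall t : R, is_derive t 1 fp.1 (\sum_k U i k t ^+ 2),
        forall t, t <= 0 -> fp.1 t = 0 &
        forall t : R, is_derive t 1 fp.2 (fp.1 t)].
  have c2 : continuous (fun t => \sum_k U i k t ^+ 2).
    move=> t; apply: cvg_sumf => k _; rewrite expr2.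
    by apply: cvgM; exact: cU.
  have z2 t : t <= 0 -> \sum_k U i k t ^+ 2 = 0.
    by move=> t0; rewrite big1// => k _; rewrite U0// expr0n.
  have [F [dF F0]] := primitive_vanishing c2 z2.
  have cF : continuous F by move=> t; exact: is_derive_continuous (dF t).
  have [Phi [dPhi _]] := primitive_vanishing cF F0.
  by exists (F, Phi).
have [fp fpP] := choice ex.
by exists (fun i => (fp i).1), (fun i => (fp i).2); split=> i; case: (fpP i).
Qed.

Theorem mainTheorem1 (R : realType) (N n : nat)
  (r Q p eps gamma eta : R)
  (E0 : rel 'I_N)
  (d : 'I_N -> 'I_N -> R -> R) (dbar : 'I_N -> 'I_N -> R)
  (K : 'I_N -> 'M[R]_n) (k : 'I_N -> R) (alpha : 'I_N -> 'I_N -> R)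
  (x u : 'I_N -> R -> 'cV[R]_n)
  (r_gt0 : 0 < r) (Q_gt0 : 0 < Q) (p_gt0 : 0 < p) (eps_gt0 : 0 < eps)
  (gamma_gt0 : 0 < gamma) (eta_gt0 : 0 < eta)
  (* the initial communication graph: simple, undirected and connected *)
  (E0_sym : symmetric E0) (E0_irr : irreflexive E0)
  (E0_conn : forall i j : 'I_N, connect E0 i j)
  (d_bound : forall (i j : 'I_N) (t : R), E0 i j -> 0 <= t ->
     0 <= d j i t <= dbar j i)
  (* initial configuration; the agents are at rest before time 0 *)
  (x_hist : forall (i : 'I_N) (t : R), t <= 0 -> x i t = x i 0)
  (x_init : forall i j : 'I_N, E0 i j -> euclid (x i 0 - x j 0) <= r - eps)
  (u_init : forall i : 'I_N, u i 0 = 0)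
  (* closed-loop dynamics *)
  (x_cont : forall i : 'I_N, {within `[0, +oo[, continuous (x i)})
  (u_cont : forall i : 'I_N, {within `[0, +oo[, continuous (u i)})
  (x_dyn : forall (i : 'I_N) (t : R), 0 < t -> is_derive t 1 (x i) (u i t))
  (u_dyn : forall (i : 'I_N) (t : R), 0 < t ->
     is_derive t 1 (u i)
       (- (p *: (\sum_(j | E0 i j) grad_psi r Q (x i t - delayed x d j i t)))
        - K i *m u i t))
  (* gains *)
  (K_diag : forall i : 'I_N, is_diag_mx (K i))
  (K_pos : forall (i : 'I_N) (a : 'I_n), 0 < K i a a)
  (k_min : forall i : 'I_N, smallest_eigenvalue (K i) (k i))
  (Q_choice : (N * (N - 1))%:R / 2 * psi r Q (r - eps) < psi r Q r)
  (mismatch : gradient_mismatch E0 r Q p d x u gamma eta)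
  (alpha_gt0 : forall i j : 'I_N, E0 i j -> 0 < alpha i j)
  (k_large : forall i : 'I_N,
     k i > \sum_(j | E0 i j)
             (alpha i j * p * (gamma + eta) / 2
              + p * (gamma + n%:R * eta) * dbar i j ^+ 2 / (2 * alpha j i))) :
  (forall (i j : 'I_N) (t : R), E0 i j -> 0 <= t -> euclid (x i t - x j t) < r)
  /\ (forall i j : 'I_N, x i t - x j t @[t --> +oo] --> (0 : 'cV[R]_n)).
Proof.
pose X i k t : R := x i t k 0.
(* The values of [u] before time 0 are unconstrained; freezing it at 0 matches the agents being at
   rest there. *)
pose U i k t : R := u i (Num.max t 0) k 0.
pose Y i j k t : R := delayed x d j i t k 0.
pose a := r ^+ 2 + Q.
have ra : r ^+ 2 < a by rewrite /a ltrDl.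
have aQ : a - r ^+ 2 = Q by rewrite /a addrAC subrr add0r.
have within_coord (h : R -> 'cV[R]_n) k' :
    {within `[0, +oo[, continuous h} ->
    {within `[0, +oo[, continuous (fun t => h t k' 0)}.
  move=> hc; apply: (@within_continuous_comp _ _ _ _ h (fun M => M k' 0)) => //.
  by move=> M _; exact: coord_continuous.
have U_rest i k' t : t <= 0 -> U i k' t = 0.
  by move=> t0; rewrite /U (elimT max_idPr t0) u_init mxE.
have U_pos i k' t : 0 <= t -> U i k' t = u i t k' 0.
  by move=> t0; rewrite /U (elimT max_idPl t0).
have cU i k' : continuous (U i k').
  exact: (continuous_max0 (within_coord _ k' (u_cont i))).
have cX i k' : continuous (X i k').
  have := continuous_max0 (within_coord _ k' (x_cont i)).
  rewrite (_ : (fun _ => _) = X i k')//; apply/funext => t; rewrite /X.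
  by have [t0|//] := leP t 0; rewrite [in RHS]x_hist.
have dX i k' (t : R) : is_derive t 1 (X i k') (U i k' t).
  move: t; apply: is_derive_from_rest => //.
  - by move=> t t0; rewrite /X x_hist.
  - exact: U_rest.
  move=> t t0; rewrite U_pos ?(ltW t0)//.
  exact: is_derive_coord (x_dyn i t t0).
have Xdiff i j t l : (x i t - x j t) l 0 = X i l t - X j l t by rewrite !mxE.
have Ydiff i j t l : (x i t - delayed x d j i t) l 0 = X i l t - Y i j l t.
  by rewrite !mxE.
have XYdiff i j t l : (x j t - delayed x d j i t) l 0 = X j l t - Y i j l t.
  by rewrite !mxE.
have sumX i j t : \sum_l (x i t - x j t) l 0 ^+ 2 = dist2 X i j t.
  by apply: eq_bigr => l _; rewrite Xdiff.
have sumY i j t : \sum_l (x i t - delayed x d j i t) l 0 ^+ 2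
    = \sum_l (X i l t - Y i j l t) ^+ 2.
  by apply: eq_bigr => l _; rewrite Ydiff.
have dU i k' (t : R) : 0 < t -> is_derive t 1 (U i k')
  (- (p * \sum_(j | E0 i j) gcoef a (\sum_l (X i l t - Y i j l t) ^+ 2)
                           * (X i k' t - Y i j k' t)) - K i k' k' * U i k' t).
  move=> t0; apply: (@near_eq_is_derive _ _ _ (fun s => u i s k' 0)).
    have : \forall s \near t, 0 < s by exact: lt_nbhsr.
    by apply: filterS => s s0; rewrite U_pos// ltW.
  apply: is_derive_eq (is_derive_coord k' 0 (u_dyn i t t0)) _.
  rewrite U_pos ?(ltW t0)// -diag_mulmx_coord// [LHS]mxE; congr (_ + _).
    rewrite [LHS]mxE [X in - X]mxE summxE; congr (- (_ * _)).
    by apply: eq_bigr => j _; rewrite grad_psi_coord sumY Ydiff.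
  by rewrite mxE.
have [F [Phi [dF F0 dPhi]]] := kinetic_primitives cU U_rest.
have F_ge0 i t : 0 <= F i t.
  have [t0|t0] := leP t 0; first by rewrite F0.
  by have := energy_primitive_nd (dF i) (ltW t0); rewrite F0.
have energyE t : 0 <= t -> energy E0 r Q p x u t = lyap E0 a p X U t.
  move=> t0; rewrite /energy /lyap; congr (_ * _ + _ * _).
    by apply: eq_bigr => i _; apply: eq_bigr => j _; rewrite psi_euclid sumX.
  apply: eq_bigr => i _; rewrite mxE; apply: eq_bigr => l _.
  by rewrite mxE U_pos// expr2.
have s_ge0 i j : E0 i j -> 0 <= r - eps.
  by move=> /x_init; apply: le_trans; exact: sqrtr_ge0.
have q_init i j : E0 i j -> 0 <= dist2 X i j 0 <= (r - eps) ^+ 2.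
  move=> Eij; rewrite -sumX -euclid_sqr sqr_ge0/=.
  by rewrite ler_sqr ?nnegrE ?sqrtr_ge0 ?(s_ge0 i j)// x_init.
have q0 i j : E0 i j -> dist2 X i j 0 < r ^+ 2.
  move=> Eij; have /andP[_] := q_init i j Eij; move/le_lt_trans; apply.
  by have := s_ge0 i j Eij => se; rewrite ltr_sqr ?nnegrE//; lra.
have psi_r : psi r Q r = r ^+ 2 / (a - r ^+ 2).
  by rewrite /psi aQ subrr add0r.
have lyap0 : lyap E0 a p X U 0
    = p / 2 * (\sum_i \sum_(j | E0 i j) dist2 X i j 0 / (a - dist2 X i j 0)).
  rewrite /lyap [X in _ + _ * X]big1 ?mulr0 ?addr0// => i _.
  by rewrite big1// => k' _; rewrite U_rest// expr0n.
have V0 : lyap E0 a p X U 0 < p * (r ^+ 2 / (a - r ^+ 2)).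
  rewrite lyap0 -psi_r.
  (* The sign of [r - eps] is known only from an edge; without edges the initial energy is an empty
     sum. *)
  have [[i [j Eij]]|noE] := pselect (exists i j, E0 i j).
    have se : 0 <= r - eps < r by have := s_ge0 i j Eij; lra.
    have := initial_potential E0_irr Q_gt0 se q_init.
    rewrite -/a => h; rewrite -mulrA ltr_pM2l//.
    apply: le_lt_trans Q_choice; rewrite mulrC [leRHS]mulrAC.
    by rewrite ler_pM2r// invr_gt0.
  rewrite big1 ?mulr0.
    by rewrite mulr_gt0// psi_r aQ divr_gt0// exprn_gt0.
  move=> i _; rewrite big_pred0// => j; apply/negP => Eij.
  by apply: noE; exists i, j.
have mm i j k' (t : R) : E0 i j -> 0 < t ->
    lyap E0 a p X U t <= lyap E0 a p X U 0 ->
  `|gcoef a (dist2 X i j t) * (X i k' t - X j k' t)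
    - gcoef a (\sum_l (X i l t - Y i j l t) ^+ 2) * (X i k' t - Y i j k' t)|
  <= gamma * `|X j k' t - Y i j k' t|
     + eta * Num.sqrt (\sum_l (X j l t - Y i j l t) ^+ 2).
  move=> Eij t0 Vt; have := mismatch t (ltW t0).
  rewrite !energyE ?(ltW t0)// psi_r => /(_ Vt V0 i j Eij k').
  rewrite [X in X <= _]mxE [X in _ <= X]mxE.
  rewrite [X in `|X|]mxE [X in `|_ + X|]mxE !grad_psi_coord.
  rewrite sumX sumY Xdiff Ydiff => /le_trans; apply; apply: lerD.
    by rewrite !mxE.
  rewrite 2!mxE mulr1; apply: ler_wpM2l; first exact: ltW.
  apply: le_trans (mx_norm_le_euclid _) _.
  by rewrite /euclid; under eq_bigr do rewrite XYdiff.
have kminP i k' : k i <= K i k' k'.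
  by case: (k_min i) => _; apply; exact: eigenvalue_diag.
have D_ge0 i j : E0 i j -> 0 <= dbar j i.
  by move=> Eij; have /andP[] := d_bound i j 0 Eij (lexx 0); exact: le_trans.
have YP i j (t : R) : E0 i j -> 0 < t ->
    exists2 s : R, t - dbar j i <= s <= t & forall k', Y i j k' t = X j k' s.
  move=> Eij t0; exists (t - d j i t) => //.
  by have /andP[] := d_bound i j t Eij (ltW t0); lra.
have margin_gt0 i : 0 < k i - \sum_(j | E0 i j)
    (alpha i j * p * (gamma + eta) / 2
      + p * (gamma + n%:R * eta) * dbar i j ^+ 2 / (2 * alpha j i)).
  by rewrite subr_gt0.
have F00 i : F i 0 = 0 by exact: F0.
split=> [i j t Eij t0|i j].
  (* [D] takes the receiver first and [dbar] the sender first, hence the transposition. *)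
  have [_ q] := lyap_invariance (D := fun i j => dbar j i) E0_sym r_gt0 ra p_gt0
    dX cU dU kminP alpha_gt0 D_ge0 (ltW gamma_gt0) (ltW eta_gt0) YP dF dPhi F00
    F_ge0 mm margin_gt0 q0 V0 t0.
  rewrite -[ltRHS](gtr0_norm r_gt0) -sqrtr_sqr ltr_sqrt ?exprn_gt0//.
  by rewrite sumX q.
apply: cvg_mx_coord => k' l; rewrite ord1.
have -> : (fun t => (x i t - x j t) k' 0) = (fun t => X i k' t - X j k' t).
  by apply/funext => t; rewrite Xdiff.
exact: (consensus (D := fun i j => dbar j i) E0_sym r_gt0 ra p_gt0
    dX cU dU kminP alpha_gt0 D_ge0 (ltW gamma_gt0) (ltW eta_gt0) YP dF dPhi F00
    F_ge0 mm margin_gt0 q0 V0 E0_conn).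
Qed.
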